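(* Let $M$ be a torus with one boundary component, so that $\pi_1(M)$ is the free group on two generators $X,Y$ and the boundary loop is $K=XYX^{-1}Y^{-1}$. Let $\sigma\in\operatorname{Hom}(\pi_1(M),\mathrm{SU}(2))$ be such that $\sigma(\pi_1(M))$ is dense in $\mathrm{SU}(2)$, and let $k=\operatorname{tr}(\sigma(K))$. Then the $\Gamma$-orbit of the conjugacy class $[\sigma]$ is dense in $E_k$.
   Context: $E=\operatorname{Hom}(\pi_1(M),\mathrm{SU}(2))/\mathrm{SU}(2)$, with $\mathrm{SU}(2)$ acting by conjugation; $[\sigma]$ denotes the class of $\sigma$. The map $[\sigma]\mapsto(x,y,z)=(\operatorname{tr}\sigma(X),\operatorname{tr}\sigma(Y),\operatorname{tr}\sigma(XY))$ (''global coordinates'') is injective. One has $\operatorname{tr}\sigma(K)=x^2+y^2+z^2-xyz-2$, and the image of $E$ is $\{(x,y,z)\in[-2,2]^3:-2\le x^2+y^2+z^2-xyz-2\le 2\}$; $E$ is identified with this set and carries the subspace topology from $\mathbb{R}^3$. For $k\in[-2,2]$, $E_k=\{[\sigma]\in E:\operatorname{tr}\sigma(K)=k\}$ (the relative character variety for the conjugacy class of trace $k$). $\Gamma$ is the mapping class group $\pi_0(\mathrm{Diff}(M,\partial M))$. It is generated by Dehn twists $\tau_X,\tau_Y$ (acting on $\pi_1$ by $\tau_X(X)=X,\ \tau_X(Y)=YX$ and $\tau_Y(X)=XY,\ \tau_Y(Y)=Y$), which act on $E$ in global coordinates by $\tau_X(x,y,z)=(x,z,xz-y)$ and $\tau_Y(x,y,z)=(z,y,yz-x)$;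 these preserve each $E_k$. *)

(* Defs.v *)
From mathcomp Require Import all_boot all_order all_algebra.
From mathcomp Require Import reals.
From mathcomp.real_closed Require Import complex.
Set Implicit Arguments. Unset Strict Implicit. Unset Printing Implicit Defensive.
Import Order.TTheory GRing.Theory Num.Theory.
Local Open Scope ring_scope.

Section Defs.
Variable R : realType.

Definition adjmx (A : 'M[R[i]]_2) : 'M[R[i]]_2 := (map_mx (@conjc R) A)^T.

Definition SU2 (A : 'M[R[i]]_2) : Prop :=
  adjmx A *m A = 1%:M /\ \det A = 1.

(* The subgroup of SU(2) generated by A and B, i.e. sigma(pi_1(M)) for the
   representation sigma of the free group <X,Y> with sigma X = A, sigma Y = B. *)
Inductive gen_sub (A B : 'M[R[i]]_2) : 'M[R[i]]_2 -> Prop :=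
| gen_one : gen_sub A B 1%:M
| gen_mulA g : gen_sub A B g -> gen_sub A B (g *m A)
| gen_mulB g : gen_sub A B g -> gen_sub A B (g *m B)
| gen_mulAV g : gen_sub A B g -> gen_sub A B (g *m invmx A)
| gen_mulBV g : gen_sub A B g -> gen_sub A B (g *m invmx B).

Definition dense_in_SU2 (S : 'M[R[i]]_2 -> Prop) : Prop :=
  forall g, SU2 g -> forall eps : R, 0 < eps ->
    exists h, S h /\ forall i j : 'I_2, Normc.normc (g i j - h i j) < eps.

(* the (real) trace of an SU(2) matrix *)
Definition rtr (A : 'M[R[i]]_2) : R := @complex.Re R (\tr A).

(* global coordinates of [sigma] *)
Definition coords (A B : 'M[R[i]]_2) : R * R * R :=
  (rtr A, rtr B, rtr (A *m B)).

(* the trace polynomial of the boundary loop K *)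
Definition kappa (p : R * R * R) : R :=
  let: (x, y, z) := p in x ^+ 2 + y ^+ 2 + z ^+ 2 - x * y * z - 2.

(* E, identified with its image in R^3 *)
Definition inE (p : R * R * R) : Prop :=
  let: (x, y, z) := p in
  [/\ -2 <= x <= 2, -2 <= y <= 2, -2 <= z <= 2 & -2 <= kappa p <= 2].

Definition inEk (k : R) (p : R * R * R) : Prop := inE p /\ kappa p = k.

(* Dehn twists in global coordinates, and their inverses *)
Definition tauX (p : R * R * R) : R * R * R :=
  let: (x, y, z) := p in (x, z, x * z - y).
Definition tauY (p : R * R * R) : R * R * R :=
  let: (x, y, z) := p in (z, y, y * z - x).
Definition tauXinv (p : R * R * R) : R * R * R :=
  let: (x, y, z) := p in (x, x * y - z, y).
Definition tauYinv (p : R * R * R) : R * R * R :=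
  let: (x, y, z) := p in (y * x - z, y, x).

Inductive gamma_orbit (p0 : R * R * R) : R * R * R -> Prop :=
| orb_base : gamma_orbit p0 p0
| orb_X p : gamma_orbit p0 p -> gamma_orbit p0 (tauX p)
| orb_Y p : gamma_orbit p0 p -> gamma_orbit p0 (tauY p)
| orb_XV p : gamma_orbit p0 p -> gamma_orbit p0 (tauXinv p)
| orb_YV p : gamma_orbit p0 p -> gamma_orbit p0 (tauYinv p).

Definition dist3 (p q : R * R * R) : R :=
  let: (x, y, z) := p in let: (x', y', z') := q in
  Num.max `|x - x'| (Num.max `|y - y'| `|z - z'|).

Definition dense_in3 (S T : R * R * R -> Prop) : Prop :=
  forall p, T p -> forall eps : R, 0 < eps -> exists q, S q /\ dist3 p q < eps.

End Defs.

(* Main.v *)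
Require Import Defs.
From mathcomp Require Import all_boot all_order all_algebra.
From mathcomp Require Import all_solvable all_field.
From mathcomp Require Import reals.
From mathcomp.real_closed Require Import complex.
From mathcomp Require Import boolp classical_sets topology normedtype realfun trigo.
From mathcomp Require Import ring lra zify.
Set Implicit Arguments. Unset Strict Implicit. Unset Printing Implicit Defensive.
Import Order.TTheory GRing.Theory Num.Theory.
Import numFieldNormedType.Exports.
Local Open Scope ring_scope.

(* Let k = kappa(p) for the coordinates p of sigma; density of the image forces
   k < 2 and excludes orbit points with two zero coordinates.

   Suppose some orbit coordinate is 2 cos t with t/pi irrational. A Dehn twist
   rotates the slice {x = 2 cos t} of E_k by t, so the closure of the orbit
   contains this slice, hence slices of irrational angle arbitrarily close to
   the equator {y = 0}, and those meet every slice of irrational angle; these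
   are dense in E_k.

   Otherwise all orbit coordinates are 2 cos of rational angles, so the traces
   of sigma lie in Z[zeta] for a root of unity zeta, and all Galois conjugates
   of the orbit stay in [-2,2]^3. A maximum principle on the slices then shows
   kappa <= 2 for each conjugate, so all conjugates of sigma are unitary. All
   conjugates of all traces are thus bounded by 2, and a trace close to 0 but
   non-zero has a non-zero integral norm of absolute value < 1. *)

(** * Roots of cyclotomic polynomials and norms *)

Section NumberTheory.
Variable F : numClosedFieldType.
Implicit Types (P : {poly int}) (r s z : F).

(** In characteristic 0 the polynomial X^n - 1 is separable, so it has n distinct roots, and n
    distinct n-th roots of unity include a primitive one. *)
Lemma exists_prim_root n : (0 < n)%N -> exists z : F, n.-primitive_root z.
Proof.
move=> n_gt0; pose p : {poly F} := 'X^n - 1.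
have [rs Dp] := closed_field_poly_normal p.
rewrite (monicP _) ?monicXnsubC ?scale1r // in Dp.
have rn1 : all n.-unity_root rs by apply/allP => z; rewrite -root_prod_XsubC -Dp.
have sz_rs : (n < (size rs).+1)%N.
  by rewrite -(size_prod_XsubC rs id) -Dp size_XnsubC.
have [|z] := hasP (has_prim_root n_gt0 rn1 _ sz_rs); last by exists z.
by rewrite -separable_prod_XsubC -Dp separable_Xn_sub_1 // pnatr_eq0 -lt0n.
Qed.

Definition ev P r : F := (map_poly intr P).[r].

Lemma evD P Q r : ev (P + Q) r = ev P r + ev Q r.
Proof. by rewrite /ev rmorphD hornerD. Qed.
Lemma evB P Q r : ev (P - Q) r = ev P r - ev Q r.
Proof. by rewrite /ev rmorphB hornerD hornerN. Qed.
Lemma evM P Q r : ev (P * Q) r = ev P r * ev Q r.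
Proof. by rewrite /ev rmorphM hornerM. Qed.
Lemma evXn n r : ev 'X^n r = r ^+ n.
Proof. by rewrite /ev map_polyXn hornerXn. Qed.

Lemma prim_root_Cyclotomic n z :
  n.-primitive_root z -> exists2 d, (0 < d)%N & ev 'Phi_d z = 0.
Proof.
move=> prim_z; have n_gt0 := prim_order_gt0 prim_z.
have : ev (\prod_(d <- divisors n) 'Phi_d) z = 0.
  rewrite prod_Cyclotomic // evB evXn /ev rmorph1 hornerC prim_expr_order //.
  by rewrite subrr.
have : all (fun d => 0 < d)%N (divisors n).
  by apply/allP => d; rewrite -dvdn_divisors // => /dvdn_gt0->.
elim: (divisors n) => [_|d ds IH] /=.
  by rewrite big_nil /ev rmorph1 hornerC => /eqP; rewrite oner_eq0.
case/andP=> d_gt0 /IH{}IH; rewrite big_cons evM => /eqP.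
by rewrite mulf_eq0 => /orP[/eqP Pd0|/eqP/IH]; first exists d.
Qed.

(** Galois conjugation of integral relations; it rests on the irreducibility of Phi_n over the
    rationals. *)
Lemma Cyclotomic_conj n P r s :
  ev 'Phi_n r = 0 -> ev 'Phi_n s = 0 -> (0 < n)%N -> ev P r = 0 -> ev P s = 0.
Proof.
move=> Phi_r Phi_s n_gt0 P_r.
pose toQ : {poly int} -> {poly rat} := map_poly intr.
have toF Q : map_poly (@ratr F) (toQ Q) = map_poly intr Q.
  by rewrite -map_poly_comp; apply: eq_map_poly => a; rewrite /= rmorph_int.
have toC Q : map_poly (@ratr algC) (toQ Q) = map_poly intr Q.
  by rewrite -map_poly_comp; apply: eq_map_poly => a; rewrite /= rmorph_int.
(* Irreducibility enters through [algC]: [g] vanishes at [r], so it is no non-zero constant and has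
   a root [w] in [algC]. The minimal polynomial of [w] is Phi_n, which therefore divides [P] over
   the rationals. *)
pose g := gcdp (toQ 'Phi_n) (toQ P).
have g_r : root (map_poly (@ratr F) g) r.
  by rewrite gcdp_map root_gcd !toF /root -/(ev _ _) Phi_r -/(ev _ _) P_r eqxx.
have [w g_w] : exists w, root (map_poly (@ratr algC) g) w.
  apply/closed_rootP; apply/negP => /size_poly1P[c c0].
  move=> gC; have : size g = 1%N.
    by move: (congr1 (size : {poly algC} -> nat) gC); rewrite size_map_poly size_polyC c0.
  move/eqP/size_poly1P => [b b0 gb]; move: g_r.
  by rewrite gb map_polyC rootC fmorph_eq0 (negPf b0).
have Phi_w : root (map_poly intr 'Phi_n : {poly algC}) w.
  by move: g_w; rewrite gcdp_map root_gcd toC => /andP[].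
have [z0 prim_z0] := C_prim_root_exists n_gt0.
have prim_w : n.-primitive_root w.
  by rewrite -(root_cyclotomic prim_z0) -(Cintr_Cyclotomic prim_z0).
have [p [Dp _] dv_p] := minCpolyP w.
have {}Dp : p = toQ 'Phi_n.
  apply: (map_inj_poly (fmorph_inj (@ratr algC))); rewrite ?rmorph0 //.
  by rewrite toC (Cintr_Cyclotomic prim_w) -(minCpoly_cyclotomic prim_w) Dp.
have : p %| toQ P.
  by move: g_w; rewrite dv_p => /dvdp_trans; apply; apply: dvdp_gcdr.
rewrite Dp -(dvdp_map (@ratr F)) !toF => /dvdpP[q Dq].
by rewrite /ev Dq hornerM -/(ev _ s) Phi_s mulr0.
Qed.

(** Roots are simple because Phi_n divides the separable X^n - 1. *)
Lemma Cyclotomic_split n : (0 < n)%N ->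
  exists2 rs : seq F, uniq rs & map_poly intr 'Phi_n = \prod_(r <- rs) ('X - r%:P).
Proof.
move=> n_gt0; have [rs Dp] := closed_field_poly_normal (map_poly intr 'Phi_n : {poly F}).
rewrite (monicP (monic_map _ (Cyclotomic_monic n))) scale1r in Dp.
exists rs => //; rewrite -separable_prod_XsubC -Dp.
have : separable_poly ('X^n - 1 : {poly F}).
  by rewrite separable_Xn_sub_1 // pnatr_eq0 -lt0n.
have -> : 'X^n - 1 = map_poly intr ('X^n - 1 : {poly int}) :> {poly F}.
  by rewrite rmorphB /= map_polyXn rmorph1.
rewrite -prod_Cyclotomic // (big_rem n) -?dvdn_divisors //=.
by rewrite rmorphM separable_mul => /and3P[].
Qed.

(* Multiplication by P on Z[t]/(Phi) has an integer matrix M; the Vandermonde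
   matrix of the roots diagonalises it, so the norm of P is det M. *)
Lemma norm_int (Phi P : {poly int}) (rs : seq F) :
    Phi \is monic -> uniq rs -> map_poly intr Phi = \prod_(r <- rs) ('X - r%:P) ->
  exists m : int, \prod_(r <- rs) ev P r = m%:~R.
Proof.
move=> monPhi uniq_rs DPhi; set n := size rs.
have szPhi : size Phi = n.+1.
  have /= := size_prod_XsubC rs (@id F); rewrite -DPhi size_map_inj_poly //.
  exact: intr_inj.
have ev_rs r : r \in rs -> ev Phi r = 0.
  by move=> rs_r; apply/rootP; rewrite DPhi root_prod_XsubC.
pose M : 'M[int]_n := \matrix_(i, j) (Pdiv.Ring.rmodp ('X^i * P) Phi)`_j.
pose a : 'rV[F]_n := \row_j rs`_j.
pose V := Vandermonde n a.
pose D : 'rV[F]_n := \row_j ev P rs`_j.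
have ev_mod Q r : ev Phi r = 0 -> ev Q r = ev (Pdiv.Ring.rmodp Q Phi) r.
  move=> Phi_r.
  by rewrite [in LHS](Pdiv.RingMonic.rdivp_eq monPhi Q) evD evM Phi_r mulr0 add0r.
have MV : map_mx intr M *m V = V *m diag_mx D.
  apply/matrixP => i j; rewrite mul_mx_diag !mxE.
  have rj : rs`_j \in rs by rewrite mem_nth.
  rewrite -evXn -evM (ev_mod _ _ (ev_rs _ rj)) /ev.
  rewrite (@horner_coef_wide _ n); last first.
    rewrite size_map_inj_poly //; last exact: intr_inj.
    by rewrite -ltnS -szPhi Pdiv.Ring.ltn_rmodpN0 // ?monic_neq0.
  by apply: eq_bigr => k _; rewrite !mxE coef_map.
have detV : \det V != 0.
  rewrite det_Vandermonde; apply/prodf_neq0 => i _; apply/prodf_neq0 => j ij.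
  by rewrite !mxE subr_eq0 nth_uniq // ?(ltn_ord) // gtn_eqF.
exists (\det M); rewrite -det_map_mx.
have := congr1 determinant MV; rewrite !det_mulmx mulrC => /(mulfI detV) ->.
rewrite det_diag (big_nth 0) big_mkord.
by apply: eq_bigr => i _; rewrite mxE.
Qed.

End NumberTheory.

(** * Traces of words and Dehn twists over a commutative ring *)

Lemma I2E (i : 'I_2) : i = 0 \/ i = 1.
Proof. by case: i => [[|[|?]] ?] //; [left|right]; apply: val_inj. Qed.

Lemma sum2 (V : nmodType) (E : 'I_2 -> V) : \sum_i E i = E 0 + E 1.
Proof. by rewrite big_ord_recl big_ord1; congr (_ + E _); apply: val_inj. Qed.

Lemma mx2P (T : Type) (A B : 'M[T]_2) :
  A 0 0 = B 0 0 -> A 0 1 = B 0 1 -> A 1 0 = B 1 0 -> A 1 1 = B 1 1 -> A = B.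
Proof.
by move=> *; apply/matrixP => i j; have [-> | ->] := I2E i; have [-> | ->] := I2E j.
Qed.

Section Words.
Variable K : comNzRingType.
Implicit Types A B g : 'M[K]_2.

Lemma mulmx2 A B i j : (A *m B) i j = A i 0 * B 0 j + A i 1 * B 1 j.
Proof. by rewrite mxE sum2. Qed.

Lemma tr2 A : \tr A = A 0 0 + A 1 1.
Proof. exact: sum2. Qed.

Lemma det2 A : \det A = A 0 0 * A 1 1 - A 0 1 * A 1 0.
Proof.
rewrite (expand_det_row _ 0) sum2 /cofactor !det_mx11 !mxE /=.
by rewrite expr0 expr1 mulN1r mul1r mulrN; congr (_ * A _ _ - _ * A _ _); apply: val_inj.
Qed.

Lemma cayley_hamilton2 A : A *m A = \tr A *: A - (\det A)%:M.
Proof. by apply: mx2P; rewrite mulmx2 !mxE tr2 det2 /=; ring. Qed.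

(** Polarised Cayley-Hamilton: it brings products back into the span of 1, A, B, AB, the four
    matrices behind [quad]. *)
Lemma cayley_hamilton2_polar A B :
  B *m A = \tr A *: B + \tr B *: A + (\tr (A *m B) - \tr A * \tr B)%:M - A *m B.
Proof. by apply: mx2P; rewrite !mxE !tr2 !sum2 !mulmx2 /=; ring. Qed.

(* A letter (b, e) stands for A if b = false, for B if b = true, inverted when
   e = true. The last letter of a word is the head of the list. *)
Definition letter A B (l : bool * bool) : 'M[K]_2 :=
  let M := if l.1 then B else A in if l.2 then (\tr M)%:M - M else M.

Fixpoint word A B (w : seq (bool * bool)) : 'M[K]_2 :=
  if w is l :: w' then word A B w' *m letter A B l else 1%:M.

(* The effect of right multiplication by a letter on the quadruple
   (tr g, tr gA, tr gB, tr gAB), where (x, y, z) = (tr A, tr B, tr AB). *)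
Definition quad_step (x y z : K) (l : bool * bool) (q : K * K * K * K) :=
  let: (t, a, b, c) := q in
  let q' := if l.1 then (b, x * b + y * a + (z - x * y) * t - c, y * b - t, a - x * t + z * b)
            else (a, x * a - t, c, x * c - b) in
  if l.2 then
    let: (t', a', b', c') := q' in
    let u := if l.1 then y else x in (u * t - t', u * a - a', u * b - b', u * c - c')
  else q'.

Definition quad_word (x y z : K) (w : seq (bool * bool)) :=
  foldr (quad_step x y z) (2, x, y, z) w.

Definition quad A B g :=
  (\tr g, \tr (g *m A), \tr (g *m B), \tr (g *m (A *m B))).

(** Cayley-Hamilton puts A^2, B^2, BA and BAB in the span of 1, A, B, AB, so the new traces are
    linear in the old ones. An inverse letter is (tr M) 1 - M. *)
Lemma quad_mul A B g l : \det A = 1 -> \det B = 1 ->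
  quad A B (g *m letter A B l) = quad_step (\tr A) (\tr B) (\tr (A *m B)) l (quad A B g).
Proof.
move=> dA dB; have CHA := cayley_hamilton2 A; have CHB := cayley_hamilton2 B.
have BA := cayley_hamilton2_polar A B; rewrite dA in CHA; rewrite dB in CHB.
have mulA : quad A B (g *m A) =
    quad_step (\tr A) (\tr B) (\tr (A *m B)) (false, false) (quad A B g).
  rewrite /quad /= -!mulmxA (mulmxA A A) CHA; congr (_, _, _, _).
    by rewrite mulmxBr -scalemxAr mulmx1 !linearB !linearZ.
  by rewrite mulmxBl -scalemxAl mul1mx mulmxBr -scalemxAr !linearB !linearZ.
have BAB : B *m (A *m B) = A - (\tr A)%:M + \tr (A *m B) *: B.
  rewrite mulmxA BA mulmxBl !mulmxDl -!scalemxAl -(mulmxA A B B) CHB.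
  rewrite mulmxBr mulmx1 -scalemxAr mul_scalar_mx.
  by apply: mx2P; rewrite !mxE /=; ring.
have mulB : quad A B (g *m B) =
    quad_step (\tr A) (\tr B) (\tr (A *m B)) (true, false) (quad A B g).
  rewrite /quad /= -!mulmxA; congr (_, _, _, _).
  - rewrite BA !(mulmxBr, mulmxDr) -!scalemxAr mul_mx_scalar.
    by rewrite !(linearB, linearD) /= !linearZ.
  - by rewrite CHB mulmxBr -scalemxAr mulmx1 !linearB !linearZ.
  rewrite BAB !(mulmxBr, mulmxDr) -scalemxAr mul_mx_scalar.
  by rewrite !(linearB, linearD) /= !linearZ.
have trZB u X Y C : \tr ((u *: X - Y) *m C) = u * \tr (X *m C) - \tr (Y *m C).
  by rewrite mulmxBl -scalemxAl linearB /= mxtraceZ.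
have quadV u M : quad A B (g *m (u%:M - M)) =
    (u * \tr g - \tr (g *m M), u * \tr (g *m A) - \tr (g *m M *m A),
     u * \tr (g *m B) - \tr (g *m M *m B),
     u * \tr (g *m (A *m B)) - \tr (g *m M *m (A *m B))).
  by rewrite mulmxBr mul_mx_scalar /quad !trZB linearB /= mxtraceZ.
case: l => [[] []] //; rewrite /letter /= quadV.
  by move: mulB; rewrite /quad /= => -[-> -> ->].
by move: mulA; rewrite /quad /= => -[-> -> ->].
Qed.

Lemma quad_wordE A B w : \det A = 1 -> \det B = 1 ->
  quad A B (word A B w) = quad_word (\tr A) (\tr B) (\tr (A *m B)) w.
Proof.
move=> dA dB; elim: w => [|l w IH] /=; last by rewrite quad_mul // IH.
by rewrite /quad !mul1mx mxtrace1.
Qed.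

(** Dihedral case: a letter A keeps the shape of the quadruple and a letter B exchanges the two
    shapes, so tr g or tr gB vanishes on every word. The next two lemmas treat the other pairs of
    vanishing coordinates. *)
Lemma quad_word_yz0 x w :
  exists a b, quad_word x 0 0 w = (a, b, 0, 0) \/ quad_word x 0 0 w = (0, 0, a, b).
Proof.
elim: w => [|[l e] w [a [b IH]]] /=; first by exists 2, x; left.
case: IH => ->; case: l e => [] [] /=;
  rewrite !(mulr0, mul0r, addr0, add0r, subr0, sub0r, oppr0, subrr);
  by eexists; eexists; (left; reflexivity) || (right; reflexivity).
Qed.

Lemma quad_word_xz0 y w :
  exists a b, quad_word 0 y 0 w = (a, 0, b, 0) \/ quad_word 0 y 0 w = (0, a, 0, b).
Proof.
elim: w => [|[l e] w [a [b IH]]] /=; first by exists 2, y; left.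
case: IH => ->; case: l e => [] [] /=;
  rewrite !(mulr0, mul0r, addr0, add0r, subr0, sub0r, oppr0, subrr);
  by eexists; eexists; (left; reflexivity) || (right; reflexivity).
Qed.

Lemma quad_word_xy0 z w :
  exists a b, quad_word 0 0 z w = (a, 0, 0, b) \/ quad_word 0 0 z w = (0, a, b, 0).
Proof.
elim: w => [|[l e] w [a [b IH]]] /=; first by exists 2, z; left.
case: IH => ->; case: l e => [] [] /=;
  rewrite !(mulr0, mul0r, addr0, add0r, subr0, sub0r, oppr0, subrr);
  by eexists; eexists; (left; reflexivity) || (right; reflexivity).
Qed.

(** [(false, e)] is tau_X and [(true, e)] is tau_Y, inverted when [e = true]. The ring is arbitrary
    so that twists also act on triples of integer polynomials. *)
Definition twist (l : bool * bool) (p : K * K * K) :=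
  let: (x, y, z) := p in
  match l with
  | (false, false) => (x, z, x * z - y)
  | (true, false) => (z, y, y * z - x)
  | (false, true) => (x, x * y - z, y)
  | (true, true) => (y * x - z, y, x)
  end.

Definition twists (w : seq (bool * bool)) p := foldr twist p w.

Lemma twists_cat w1 w2 p : twists (w1 ++ w2) p = twists w1 (twists w2 p).
Proof. exact: foldr_cat. Qed.

(** A mapping class permuting the coordinates cyclically; thanks to it, statements about first
    coordinates of orbit points cover all three. *)
Definition cyc_word := [:: (false, true); (false, true); (true, false); (false, true)].

Lemma twists_cyc x y z : twists cyc_word (x, y, z) = (y, z, x).
Proof. by rewrite /=; congr (_, _, _); ring. Qed.

End Words.

Definition map3 (K L : Type) (f : K -> L) (p : K * K * K) :=
  let: (x, y, z) := p in (f x, f y, f z).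

Section Map.
Variables (K L : comNzRingType) (f : {rmorphism K -> L}).

Lemma map_twists w p : map3 f (twists w p) = twists w (map3 f p).
Proof.
elim: w => //= l w <-; case: (twists w p) => [[x y] z].
by case: l => [[] []] /=; rewrite rmorphB rmorphM.
Qed.

Lemma map_quad_word x y z w :
  let: (t, a, b, c) := quad_word x y z w in
  quad_word (f x) (f y) (f z) w = (f t, f a, f b, f c).
Proof.
elim: w => [|l w] /=; first by rewrite rmorph_nat.
case: (quad_word x y z w) => [[[t a] b] c] ->.
by case: l => [[] []] /=; rewrite !(rmorphB, rmorphD, rmorphM).
Qed.
End Map.

(** * SU(2) *)

Section SU2.
Variable R : realType.
Implicit Types A B g : 'M[R[i]]_2.
Local Notation Re := (@complex.Re R).
Local Notation Im := (@complex.Im R).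
Local Notation toC := (real_complex R).

Lemma SU2_1 : SU2 (1%:M : 'M[R[i]]_2).
Proof. by split; rewrite ?det1 // /adjmx map_mx1 trmx1 mul1mx. Qed.

Lemma SU2_mul A B : SU2 A -> SU2 B -> SU2 (A *m B).
Proof.
case=> UA dA [UB dB]; split; last by rewrite det_mulmx dA dB mulr1.
rewrite /adjmx map_mxM trmx_mul -mulmxA (mulmxA _ A) -/(adjmx A) UA mul1mx.
exact: UB.
Qed.

Lemma det1_invmx A : \det A = 1 -> invmx A = (\tr A)%:M - A.
Proof.
move=> dA; have uA : A \in unitmx by rewrite unitmxE dA unitr1.
apply: (can_inj (mulKmx uA)); rewrite mulmxV // mulmxBr mul_mx_scalar.
by rewrite cayley_hamilton2 dA opprB addrC subrK.
Qed.

Lemma SU2_invmx A : SU2 A -> adjmx A = invmx A.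
Proof.
case=> UA dA; have uA : A \in unitmx by rewrite unitmxE dA unitr1.
by apply: (can_inj (mulmxK uA)); rewrite UA mulVmx.
Qed.

Lemma SU2_entries A : SU2 A -> A 1 1 = conjc (A 0 0) /\ A 0 1 = - conjc (A 1 0).
Proof.
move=> sA; have := SU2_invmx sA; rewrite det1_invmx ?sA.2 // tr2 => E.
have := congr1 (fun M : 'M_2 => M 0 0) E; have := congr1 (fun M : 'M_2 => M 0 1) E.
rewrite !mxE /= => -> ->; split; first by ring.
by rewrite mulr0n sub0r opprK.
Qed.

Definition su2 (a b : R[i]) : 'M[R[i]]_2 :=
  \matrix_(i, j) (if i == 0 then if j == 0 then a else - conjc b
                  else if j == 0 then b else conjc a).

Definition sqn (a : R[i]) : R := Re a ^+ 2 + Im a ^+ 2.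

Lemma SU2E A : SU2 A -> A = su2 (A 0 0) (A 1 0).
Proof. by move=> /SU2_entries[e1 e2]; apply: mx2P; rewrite !mxE. Qed.

Lemma su2_SU2 a b : sqn a + sqn b = 1 -> SU2 (su2 a b).
Proof.
case: a b => [a a'] [b b']; rewrite /sqn /= => h; split.
  apply: mx2P; rewrite mulmx2 !mxE /=; apply/eqP; rewrite eq_complex /=;
  by apply/andP; split; apply/eqP; rewrite -?h; ring.
rewrite det2 !mxE /=; apply/eqP; rewrite eq_complex /=.
by apply/andP; split; apply/eqP; rewrite -?h; ring.
Qed.

Lemma SU2_sqn A : SU2 A -> sqn (A 0 0) + sqn (A 1 0) = 1.
Proof.
move=> sA; have := sA.2; rewrite (SU2E sA) det2 !mxE /=.
case: (A 0 0) (A 1 0) => [a a'] [b b'] /= /eqP; rewrite eq_complex /sqn /=.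
by case/andP => /eqP <- _; ring.
Qed.

Lemma SU2_tr A : SU2 A -> \tr A = toC (rtr A).
Proof.
move=> sA; rewrite /rtr tr2 (SU2_entries sA).1; case: (A 0 0) => a a'.
by apply/eqP; rewrite eq_complex /= addrN !eqxx.
Qed.

Lemma rtr_su2 a b : rtr (su2 a b) = 2 * Re a.
Proof. by rewrite /rtr tr2 !mxE /=; case: a => a a' /=; ring. Qed.

Lemma SU2_rtr_bound A : SU2 A -> -2 <= rtr A <= 2.
Proof.
move=> sA; have := SU2_sqn sA; rewrite (SU2E sA) rtr_su2 !mxE /sqn /=; nra.
Qed.

Lemma SU2_inv A : SU2 A -> SU2 (invmx A).
Proof.
move=> sA; rewrite -SU2_invmx //; split.
  have := sA.1; rewrite {1}SU2_invmx // => /(congr1 (fun M => A *m M)).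
  have uA : A \in unitmx by rewrite unitmxE sA.2 unitr1.
  rewrite mulmx1 => _; have -> : adjmx (adjmx A) = A.
    by apply/matrixP => i j; rewrite !mxE conjcK.
  by rewrite SU2_invmx // mulmxV.
by rewrite SU2_invmx // det_inv sA.2 invr1.
Qed.

Lemma gen_sub_SU2 A B g : SU2 A -> SU2 B -> gen_sub A B g -> SU2 g.
Proof.
move=> sA sB; elim=> [|h _ ?|h _ ?|h _ ?|h _ ?]; first exact: SU2_1;
by apply: SU2_mul => //; apply: SU2_inv.
Qed.

Lemma gen_sub_word A B g : SU2 A -> SU2 B -> gen_sub A B g -> exists w, g = word A B w.
Proof.
move=> sA sB; elim=> [|h _ [w ->]|h _ [w ->]|h _ [w ->]|h _ [w ->]].
- by exists [::].
- by exists ((false, false) :: w).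
- by exists ((true, false) :: w).
- by exists ((false, true) :: w); rewrite det1_invmx ?sA.2.
- by exists ((true, true) :: w); rewrite det1_invmx ?sB.2.
Qed.

Lemma word_SU2 A B w : SU2 A -> SU2 B -> SU2 (word A B w).
Proof.
move=> sA sB; elim: w => [|[l e] w IH] /=; first exact: SU2_1.
apply: SU2_mul => //; rewrite /letter /=.
by case: l e => [] [] //; rewrite -det1_invmx ?sA.2 ?sB.2 //; apply: SU2_inv.
Qed.

Lemma map_coords A B : SU2 A -> SU2 B ->
  map3 toC (coords A B) = (\tr A, \tr B, \tr (A *m B)).
Proof. by move=> sA sB; rewrite /= -!SU2_tr //; apply: SU2_mul. Qed.

(** K is a word of four letters, so its trace comes out of the recursion on quadruples, run over the
    reals and mapped to the complex numbers. *)
Lemma commutator_trace A B : SU2 A -> SU2 B ->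
  rtr (A *m B *m invmx A *m invmx B) = kappa (coords A B).
Proof.
move=> sA sB.
pose w := [:: (true, true); (false, true); (true, false); (false, false)].
have -> : A *m B *m invmx A *m invmx B = word A B w.
  by rewrite /= /letter /= !det1_invmx ?sA.2 ?sB.2 // mul1mx.
have := map_quad_word (real_complex R : {rmorphism R -> R[i]}) (rtr A) (rtr B) (rtr (A *m B)) w.
have := quad_wordE w sA.2 sB.2; rewrite /quad (SU2_tr (word_SU2 w sA sB)).
rewrite [\tr A](SU2_tr sA) [\tr B](SU2_tr sB) [\tr (A *m B)](SU2_tr (SU2_mul sA sB)) => <-.
by case: (quad_word (rtr A) (rtr B) (rtr (A *m B)) w) =>
  [[[t a] b] c] [E _ _ _]; rewrite E /=; ring.
Qed.

Lemma kappa_le2 A B : SU2 A -> SU2 B -> kappa (coords A B) <= 2.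
Proof.
move=> sA sB; rewrite -commutator_trace //.
by have /andP[] := SU2_rtr_bound (SU2_mul (SU2_mul (SU2_mul sA sB) (SU2_inv sA)) (SU2_inv sB)).
Qed.

(** A is taken diagonal with entries x/2 + iv and x/2 - iv, and B with upper left entry y/2 + i
    b2. *)
Lemma coords_surj (x y z : R) :
  -2 <= x <= 2 -> -2 <= y <= 2 -> -2 <= z <= 2 -> kappa (x, y, z) <= 2 ->
  exists A B, [/\ SU2 A, SU2 B & coords A B = (x, y, z)].
Proof.
move=> hx hy hz; rewrite /kappa => hk.
pose v := Num.sqrt (1 - x ^+ 2 / 4).
have v2 : v ^+ 2 = 1 - x ^+ 2 / 4 by rewrite sqr_sqrtr //; nra.
(* Here tr AB = 2 (xy/4 - v b2), which prescribes [b2]; the inequality leaves room to complete the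
   first column of B to a unit vector. *)
suff [b2 [bv bn]] : exists b2, x / 2 * (y / 2) - v * b2 = z / 2 /\ (y / 2) ^+ 2 + b2 ^+ 2 <= 1.
  exists (su2 (Complex (x / 2) v) 0).
  exists (su2 (Complex (y / 2) b2) (Complex (Num.sqrt (1 - (y / 2) ^+ 2 - b2 ^+ 2)) 0)).
  split; try by apply: su2_SU2; rewrite /sqn /= ?sqr_sqrtr ?v2 //; [field | nra | ring].
  - by apply: su2_SU2; rewrite /sqn /= v2; field.
  - by apply: su2_SU2; rewrite /sqn /= ?sqr_sqrtr //; [ring | nra].
  rewrite /coords !rtr_su2 /=; congr (_, _, _); [by field | by field |].
  rewrite /rtr tr2 !mulmx2 !mxE /= .
  rewrite -[RHS](_ : 2 * (z / 2) = z); last by field.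
  rewrite -bv /=; ring.
(* If v = 0 then A is 1 or -1, and kappa <= 2 forces xy = 2z, so the trace equation does not
   constrain [b2]. *)
have [v0|v0] := eqVneq v 0.
  have x2 : x ^+ 2 = 4 by move: v2; rewrite v0; lra.
  exists (Num.sqrt (1 - (y / 2) ^+ 2)); rewrite sqr_sqrtr; last nra.
  split; last by lra.
  have : (x * y - 2 * z) ^+ 2 = 0.
    apply/eqP; rewrite eq_le sqr_ge0 andbT; nra.
  move/eqP; rewrite sqrf_eq0 v0 => /eqP; lra.
exists ((x * y / 4 - z / 2) / v); split; first by field.
rewrite (expr_div_n (x * y / 4 - z / 2)) -lerBrDl ler_pdivrMr ?exprn_even_gt0 // v2.
nra.
Qed.

Lemma gamma_orbitP (p q : R * R * R) : gamma_orbit p q <-> exists w, q = twists w p.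
Proof.
split=> [|[w ->]].
  elim=> [|_ _ [w ->]|_ _ [w ->]|_ _ [w ->]|_ _ [w ->]]; first by exists [::].
  - by exists ((false, false) :: w).
  - by exists ((true, false) :: w).
  - by exists ((false, true) :: w).
  - by exists ((true, true) :: w).
elim: w => [|l w IH] /=; first exact: orb_base.
case: l => [[] []]; [have := orb_YV IH | have := orb_Y IH | have := orb_XV IH | have := orb_X IH];
  by case: (twists w p) => [[x y] z].
Qed.

End SU2.

(** * Consequences of density *)

Section Density.
Variable R : realType.
Implicit Types A B g : 'M[R[i]]_2.

Lemma normc_lt (z : R[i]) (e : R) : 0 < e -> Normc.normc z < e ->
  - e < complex.Re z < e /\ - e < complex.Im z < e.
Proof.
case: z => a b /= e0 h; have n2 : Num.sqrt (a ^+ 2 + b ^+ 2) ^+ 2 < e ^+ 2.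
  by rewrite ltr_pXn2r // nnegrE ?sqrtr_ge0 // ltW.
rewrite sqr_sqrtr in n2; last by rewrite addr_ge0 ?sqr_ge0.
by split; apply/andP; split; nra.
Qed.

Lemma dense_su2 A B (a1 a2 b1 b2 e : R) : SU2 A -> SU2 B -> dense_in_SU2 (gen_sub A B) ->
    a1 ^+ 2 + a2 ^+ 2 + (b1 ^+ 2 + b2 ^+ 2) = 1 -> 0 < e ->
  exists c1 c2 d1 d2, [/\ gen_sub A B (su2 (Complex c1 c2) (Complex d1 d2)),
    - e < a1 - c1 < e, - e < a2 - c2 < e, - e < b1 - d1 < e & - e < b2 - d2 < e].
Proof.
move=> sA sB dAB ab1 e0.
have sg := @su2_SU2 _ (Complex a1 a2) (Complex b1 b2) ab1.
have [h [Gh dh]] := dAB _ sg e e0.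
have eh := SU2E (gen_sub_SU2 sA sB Gh).
move: Gh (normc_lt e0 (dh 0 0)) (normc_lt e0 (dh 1 0)); rewrite eh !mxE /=.
case: (h 0 0) (h 1 0) => [c1 c2] [d1 d2] /= Gh [h1 h2] [h3 h4].
by exists c1, c2, d1, d2.
Qed.

Lemma dense_small_trace A B (e : R) : SU2 A -> SU2 B -> dense_in_SU2 (gen_sub A B) ->
  0 < e -> exists2 g, gen_sub A B g & 0 < rtr g < e.
Proof.
(* The target has trace 2t; an error below t/2 in the real part leaves a trace in (t, 3t), inside
   (0, e). *)
move=> sA sB dAB e0; pose t := Num.min e 1 / 4.
have t0 : 0 < t by rewrite divr_gt0 // lt_min e0 ltr01.
have te : t <= e / 4 by rewrite /t ler_pM2r ?invr_gt0 // ge_min lexx.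
have t1 : t <= 1 / 4 by rewrite /t ler_pM2r ?invr_gt0 // ge_min lexx orbT.
have [] := @dense_su2 A B t (Num.sqrt (1 - t ^+ 2)) 0 0 (t / 2) sA sB dAB.
- by rewrite sqr_sqrtr ?expr0n /=; [ring | nra].
- lra.
move=> c1 [c2] [d1] [d2] [Gh h _ _ _]; eexists; first exact: Gh.
rewrite rtr_su2 /=; lra.
Qed.

(** Since tr M = 0 gives M^2 = -1, the element g = (1 - M)/sqrt 2 has tr g = tr gM = sqrt 2, and
    both traces stay non-zero nearby. *)
Lemma dense_trace_mul_neq0 A B M : SU2 A -> SU2 B -> dense_in_SU2 (gen_sub A B) ->
  SU2 M -> rtr M = 0 -> exists2 g, gen_sub A B g & rtr g * rtr (g *m M) != 0.
Proof.
move=> sA sB dAB sM; have := SU2_sqn sM; rewrite (SU2E sM) rtr_su2 !mxE /= /sqn.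
case: (M 0 0) (M 1 0) => [m1 m2] [n1 n2] /= h m10.
have {}m10 : m1 = 0 by lra.
pose s : R := Num.sqrt (1 / 2).
have s2 : s ^+ 2 = 1 / 2 by rewrite sqr_sqrtr // divr_ge0.
have s0 : 0 <= s by rewrite sqrtr_ge0.
have s7 : 7 / 10 < s by nra.
subst m1.
have [] := @dense_su2 A B s (- s * m2) (- s * n1) (- s * n2) (1 / 8) sA sB dAB.
- by rewrite !exprMn sqrrN s2; lra.
- lra.
move=> c1 [c2] [d1] [d2] [Gh h1 h2 h3 h4]; eexists; first exact: Gh.
have -> : rtr (su2 (Complex c1 c2) (Complex d1 d2) *m su2 (Complex 0 m2) (Complex n1 n2))
   = 2 * (- c2 * m2 - d1 * n1 - d2 * n2).
  by rewrite /rtr tr2 !mulmx2 !mxE /=; ring.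
rewrite rtr_su2 /= !mulf_neq0 ?pnatr_eq0 //; first by apply/eqP; lra.
have Ea (u v e : R) : - (1/8) < u < 1/8 -> v ^+ 2 <= 1 -> u * v <= 1/8.
  move=> hu hv; have : -1 <= v <= 1 by nra.
  by case/andP; nra.
have k1 := Ea (- (- s * m2 - c2)) m2 0; have k2 := Ea (-(- s * n1 - d1)) n1 0.
have k3 := Ea (- (- s * n2 - d2)) n2 0.
have {}k1 := k1 ltac:(lra) ltac:(nra).
have {}k2 := k2 ltac:(lra) ltac:(nra).
have {}k3 := k3 ltac:(lra) ltac:(nra).
apply/eqP => E.
have : s * (m2 ^+ 2 + n1 ^+ 2 + n2 ^+ 2) <= 3/8 by nra.
have -> : m2 ^+ 2 + n1 ^+ 2 + n2 ^+ 2 = 1 by lra.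
lra.
Qed.

Lemma gen_sub_comm A B X g : A \in unitmx -> B \in unitmx ->
  A *m X = X *m A -> B *m X = X *m B -> gen_sub A B g -> g *m X = X *m g.
Proof.
move=> uA uB AX BX.
have comV M : M \in unitmx -> M *m X = X *m M -> invmx M *m X = X *m invmx M.
  move=> uM MX; apply: (can_inj (mulKmx uM)); apply: (can_inj (mulmxK uM)).
  by rewrite mulKVmx // !mulmxA MX -!mulmxA mulVmx // mulmx1 .
elim=> [|h _ IH|h _ IH|h _ IH|h _ IH]; first by rewrite mul1mx mulmx1.
- by rewrite -mulmxA AX !mulmxA IH.
- by rewrite -mulmxA BX !mulmxA IH.
- by rewrite -mulmxA comV // !mulmxA IH.
- by rewrite -mulmxA comV // !mulmxA IH.
Qed.

Lemma SU2_rtr2 A : SU2 A -> rtr A = 2 -> A = 1%:M.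
Proof.
move=> sA; have := SU2_sqn sA; rewrite (SU2E sA) rtr_su2 !mxE /= /sqn.
case: (A 0 0) (A 1 0) => [a1 a2] [b1 b2] /= h ha.
have {ha}a1E : a1 = 1 by lra.
have sq0 (u : R) : u ^+ 2 <= 0 -> u = 0.
  by move=> u0; apply/eqP; rewrite -sqrf_eq0 eq_le u0 sqr_ge0.
have -> : a2 = 0 by apply: sq0; nra.
have -> : b1 = 0 by apply: sq0; nra.
have -> : b2 = 0 by apply: sq0; nra.
by rewrite a1E; apply: mx2P; rewrite !mxE /= ?oppr0.
Qed.

(** Trace 2 for K means K = 1, so A and B commute and the whole image is abelian. *)
Lemma dense_kappa_lt2 A B : SU2 A -> SU2 B -> dense_in_SU2 (gen_sub A B) ->
  kappa (coords A B) < 2.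
Proof.
move=> sA sB dAB; rewrite lt_neqAle kappa_le2 // andbT; apply/eqP.
rewrite -commutator_trace // => k2.
have uA : A \in unitmx by rewrite unitmxE sA.2 unitr1.
have uB : B \in unitmx by rewrite unitmxE sB.2 unitr1.
pose K := A *m B *m invmx A *m invmx B.
have sK : SU2 K by rewrite /K; do ?apply: SU2_mul => //; apply: SU2_inv.
have K1 := SU2_rtr2 sK k2.
have AB : A *m B = B *m A.
  have -> : A *m B = K *m (B *m A) by rewrite /K !mulmxA !mulmxKV.
  by rewrite K1 mul1mx.
have comG g h : gen_sub A B g -> gen_sub A B h -> g *m h = h *m g.
  move=> Gg Gh; apply: (gen_sub_comm uA uB) Gg; apply/esym;
  exact: (gen_sub_comm uA uB) Gh.
(* Two anticommuting quaternion units are approximated; the upper left entries of their two products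
   are -i and i, too far apart for commuting approximants. *)
have [] := @dense_su2 A B 0 0 1 0 (1 / 4) sA sB dAB; [by ring | lra |].
move=> c1 [c2] [d1] [d2] [Gg _ _ hd1 hd2].
have [] := @dense_su2 A B 0 0 0 1 (1 / 4) sA sB dAB; [by ring | lra |].
move=> c3 [c4] [d3] [d4] [Gh _ _ hd3 hd4].
have := congr1 (fun M : 'M[R[i]]_2 => complex.Im (M 0 0)) (comG _ _ Gg Gh).
rewrite !mulmx2 !mxE /= => E; nra.
Qed.

(** With two coordinates zero, tr g tr gM vanishes on all words for M = A or M = B, against
    [dense_trace_mul_neq0]. *)
Lemma dense_not_dihedral A B : SU2 A -> SU2 B -> dense_in_SU2 (gen_sub A B) ->
  let: (x, y, z) := coords A B in
  ~ (y = 0 /\ z = 0) /\ ~ (x = 0 /\ z = 0) /\ ~ (x = 0 /\ y = 0).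
Proof.
move=> sA sB dAB; rewrite /coords.
have sAB := SU2_mul sA sB.
have tr0 (M : 'M[R[i]]_2) : SU2 M -> (\tr M = 0) <-> (rtr M = 0).
  by move=> sM; rewrite SU2_tr //; split => [/complexI|->].
have key (M g : 'M[R[i]]_2) : SU2 M -> SU2 g ->
    \tr g = 0 \/ \tr (g *m M) = 0 -> rtr g * rtr (g *m M) = 0.
  by move=> sM sg [/(tr0 _ sg)|/(tr0 _ (SU2_mul sg sM))] ->; rewrite ?mul0r ?mulr0.
have trw w : quad A B (word A B w) = quad_word (\tr A) (\tr B) (\tr (A *m B)) w.
  by rewrite quad_wordE ?sA.2 ?sB.2.
split; last split.
- case=> y0 z0; have [g /(gen_sub_word sA sB)[w ->] /eqP[]] := dense_trace_mul_neq0 sA sB dAB sB y0.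
  apply: key => //; first exact: word_SU2.
  move: (trw w); rewrite /quad ((tr0 _ sB).2 y0) ((tr0 _ sAB).2 z0).
  by have [a [b [|]]] := quad_word_yz0 (\tr A) w => -> [? ? ? ?]; auto.
- case=> x0 z0; have [g /(gen_sub_word sA sB)[w ->] /eqP[]] := dense_trace_mul_neq0 sA sB dAB sA x0.
  apply: key => //; first exact: word_SU2.
  move: (trw w); rewrite /quad ((tr0 _ sA).2 x0) ((tr0 _ sAB).2 z0).
  by have [a [b [|]]] := quad_word_xz0 (\tr B) w => -> [? ? ? ?]; auto.
case=> x0 y0; have [g /(gen_sub_word sA sB)[w ->] /eqP[]] := dense_trace_mul_neq0 sA sB dAB sA x0.
apply: key => //; first exact: word_SU2.
move: (trw w); rewrite /quad ((tr0 _ sA).2 x0) ((tr0 _ sB).2 y0).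
by have [a [b [|]]] := quad_word_xy0 (\tr (A *m B)) w => -> [? ? ? ?]; auto.
Qed.

End Density.

(** * The maximum principle *)

Section MaxPrinciple.
Variable R : realType.
Implicit Types (p q : R * R * R).

Lemma sup_approx (P : R -> Prop) (b : R) : (exists u, P u) -> (forall u, P u -> u <= b) ->
  exists s, [/\ s <= b, forall u, P u -> u <= s & forall e, 0 < e -> exists2 u, P u & s - e < u].
Proof.
move=> [u0 Pu0] Pb; have hP : has_sup P by split; [exists u0 | exists b => u /Pb].
exists (sup P); split.
- by apply: ge_sup; [exists u0 | move=> u /Pb].
- by move=> u Pu; apply: ub_le_sup => //; exact: hP.2.
- by move=> e e0; have [u Pu ue] := sup_adherent e0 hP; exists u.
Qed.

Lemma gamma_orbit_cyc p x y z : gamma_orbit p (x, y, z) -> gamma_orbit p (y, z, x).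
Proof.
case/gamma_orbitP => w E; apply/gamma_orbitP; exists (cyc_word ++ w).
by rewrite twists_cat -E twists_cyc.
Qed.

Lemma kappa_orbit p q : gamma_orbit p q -> kappa q = kappa p.
Proof.
case/gamma_orbitP => w ->; elim: w => //= l w <-.
by case: (twists w p) => [[x y] z]; case: l => [[] []]; rewrite /kappa /=; ring.
Qed.

(* On the slice x = const the neighbours z, z' of y satisfy z + z' = x y and
   z z' = y^2 + x^2 - 2 - kappa; if |z|, |z'| <= nu with nu the supremum of |y|,
   then (nu - |z|)(nu - |z'|) >= 0 bounds kappa, and so does letting |x| tend to
   the supremum mu >= nu: kappa - 2 <= -(mu - 2)^2 (mu + 1). *)
Lemma orbit_box_kappa p :
  (forall x y z, gamma_orbit p (x, y, z) -> `|x| <= 2) -> kappa p <= 2.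
Proof.
move=> box; set k := kappa p.
have [mu [mu2 le_mu mu_near]] := @sup_approx
  (fun u => exists y z, exists2 x, u = `|x| & gamma_orbit p (x, y, z)) 2
  ltac:(by case: (p) => [[x y] z]; exists `|x|, y, z, x => //; exact: orb_base)
  ltac:(by move=> u [y [z [x -> /box]]]).
have slice x y z : gamma_orbit p (x, y, z) -> 2 + k - x ^+ 2 <= (2 - `|x|) * mu ^+ 2.
  move=> Oxyz; have x2 := box _ _ _ Oxyz.
  (* [nu] is the supremum of |y'| over orbit points with this same [x]; cyclic permutation gives
     [nu <= mu]. *)
  have [nu [numu le_nu nu_near]] := @sup_approx
    (fun u => exists2 y', u = `|y'| & exists z', gamma_orbit p (x, y', z')) mu
    ltac:(by exists `|y|, y => //; exists z)
    ltac:(by move=> u [y' -> [z' /gamma_orbit_cyc O']]; apply: le_mu; exists z', x, y').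
  have near y' z' : gamma_orbit p (x, y', z') ->
      2 + k - x ^+ 2 <= nu ^+ 2 + `|y'| ^+ 2 - `|x| * `|y'| * nu.
    move=> O'; have : `|z'| <= nu.
      by apply: le_nu; exists z' => //; exists (x * z' - y'); exact: (orb_X O').
    have : `|x * y' - z'| <= nu.
      by apply: le_nu; exists (x * y' - z') => //; exists y'; exact: (orb_XV O').
    rewrite real_normK ?num_real // !ler_norml -normrM.
    have : kappa (x, y', z') = k by exact: kappa_orbit.
    rewrite /kappa; move: (x * y') (normrM x y') => t _ <-.
    move=> /andP[a1 a2] /andP[b1 b2].
    have p1 : 0 <= (nu - z') * (nu - (t - z')) by rewrite mulr_ge0 //; lra.
    have p2 : 0 <= (nu + z') * (nu + (t - z')) by rewrite mulr_ge0 //; lra.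
    by have [t0|t0] := ger0P t; nra.
  have nu0 : 0 <= nu by apply: le_trans (normr_ge0 y) _; apply: le_nu; exists y => //; exists z.
  have lim : 2 + k - x ^+ 2 <= (2 - `|x|) * nu ^+ 2.
    apply/ler_addgt0Pr => e e0.
    (* The tolerance e/4 absorbs the factor |x| nu <= 4. *)
    have [_ [y' -> [z' O']] ny] := nu_near (e / 4) ltac:(lra).
    have yn : `|y'| <= nu by apply: le_nu; exists y' => //; exists z'.
    apply: le_trans (near _ _ O') _.
    have : `|y'| ^+ 2 <= nu ^+ 2 by rewrite ler_pXn2r // nnegrE.
    have : `|x| * nu * (nu - `|y'|) <= 4 * (nu - `|y'|).
      have h4 : `|x| * nu <= 4.
        have := ler_pM (normr_ge0 x) nu0 x2 (le_trans numu mu2); lra.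
      by apply: ler_wpM2r h4; lra.
    lra.
  apply: le_trans lim _; apply: ler_wpM2l; first by lra.
  by rewrite ler_pXn2r // nnegrE (le_trans nu0).
apply/ler_addgt0Pr => e e0.
have [_ [y [z [x -> O']]] xn] := mu_near (e / 4) ltac:(lra).
have xm : `|x| <= mu by apply: le_mu; exists y, z, x.
have := slice _ _ _ O'; rewrite -(real_normK (num_real x)).
move: (normr_ge0 x) xn xm; move: (`|x|) => u u0 un um h.
have h1 : u ^+ 2 <= mu ^+ 2 by rewrite ler_pXn2r // nnegrE // (le_trans u0).
have h2 : (mu - u) * mu ^+ 2 <= (e / 4) * 4.
  by apply: ler_pM; [lra | exact: sqr_ge0 | lra | nra].
have : 0 <= (2 - mu) ^+ 2 * (mu + 1) by rewrite mulr_ge0 ?sqr_ge0 //; lra.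
nra.
Qed.

End MaxPrinciple.

(** * Orbits of rational angles *)

(** Chebyshev polynomials normalised so that 2 cos t goes to 2 cos (nt), and s + 1/s to s^n +
    s^-n. *)
Fixpoint cheb (K : comNzRingType) (n : nat) (t : K) : K :=
  match n with
  | 0 => 2
  | n'.+1 => match n' with 0 => t | n''.+1 => t * cheb n' t - cheb n'' t end
  end.

Lemma chebSS (K : comNzRingType) n (t : K) :
  cheb n.+2 t = t * cheb n.+1 t - cheb n t.
Proof. by []. Qed.

Lemma nat_ind2 (P : nat -> Prop) :
  P 0 -> P 1 -> (forall n, P n -> P n.+1 -> P n.+2) -> forall n, P n.
Proof.
move=> P0 P1 PS n; suff : P n /\ P n.+1 by case.
by elim: n => // n [Pn Pn1]; split=> //; apply: PS.
Qed.

Lemma cheb_morph (K L : comNzRingType) (f : {rmorphism K -> L}) n t :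
  f (cheb n t) = cheb n (f t).
Proof.
elim/nat_ind2: n => [|//|n IH1 IH2]; first exact: rmorph_nat.
by rewrite !chebSS rmorphB rmorphM IH1 IH2.
Qed.

Lemma cheb_inv (K : fieldType) n (s : K) : s != 0 ->
  cheb n (s + s^-1) = s ^+ n + s ^- n.
Proof.
move=> s0; elim/nat_ind2: n => [|//|n IH1 IH2]; first by rewrite invr1.
rewrite chebSS IH1 IH2 -!exprVn !exprS.
have -> : (s + s^-1) * (s * s ^+ n + s^-1 * s^-1 ^+ n) - (s ^+ n + s^-1 ^+ n) =
   s * (s * s ^+ n) + s^-1 * (s^-1 * s^-1 ^+ n) + (s * s^-1 - 1) * (s ^+ n + s^-1 ^+ n) by ring.
by rewrite divff // subrr mul0r addr0.
Qed.

Section RationalAngle.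
Variable R : realType.
Local Notation toC := (real_complex R).

(** Let s solve s^2 - vs + 1 = 0; the hypothesis s^m + s^-m = 2 says (s^m - 1)^2 = 0. *)
Lemma cheb_eq2 m (v : R[i]) : (0 < m)%N -> cheb m v = 2 ->
  exists2 s, s ^+ m = 1 & v = s + s^-1.
Proof.
move=> m0; pose s := v / 2 + sqrtC ((v / 2) ^+ 2 - 1).
have s_eq : s * (v - s) = 1.
  have -> : s * (v - s) = (v / 2) ^+ 2 - sqrtC ((v / 2) ^+ 2 - 1) ^+ 2.
    by rewrite /s; field.
  by rewrite sqrtCK; ring.
have s0 : s != 0 by apply/eqP => s0; move/eqP: s_eq; rewrite s0 mul0r eq_sym oner_eq0.
have vE : v = s + s^-1.
  by apply: (mulfI s0); rewrite mulrDr divff // -s_eq; ring.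
rewrite {1}vE cheb_inv // => E; exists s => //.
have sm0 : s ^+ m != 0 by rewrite expf_neq0.
apply/eqP; rewrite -subr_eq0 -sqrf_eq0.
have -> : (s ^+ m - 1) ^+ 2 = s ^+ m * (s ^+ m + s ^- m - 2) by field.
by rewrite E subrr mulr0.
Qed.

Lemma root1_real m (s : R[i]) : (0 < m)%N -> s ^+ m = 1 ->
  exists2 u : R, s + s^-1 = toC u & `|u| <= 2.
Proof.
move=> m0 sm; have ns : `|s| = 1.
  by apply/eqP; rewrite -(pexpr_eq1 m0) // -normrX sm normr1.
exists (2 * complex.Re s).
  by rewrite invc_norm ns expr1n invr1 mul1r addcJ rmorphM rmorph_nat.
rewrite normrM ger0_norm // -[leRHS]mulr1 ler_pM2l //.
by rewrite -lecR -[leRHS]ns; exact: normc_ge_Re.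
Qed.

Lemma cheb_eq2_real m (v : R[i]) : (0 < m)%N -> cheb m v = 2 ->
  exists2 u : R, v = toC u & `|u| <= 2.
Proof. by move=> m0 /(cheb_eq2 m0)[s sm ->]; apply: root1_real sm. Qed.

(** That t is 2 cos of a rational multiple of pi, put as an integral polynomial equation so that it
    passes to Galois conjugates. *)
Definition rational_angle (t : R) := exists2 m, (0 < m)%N & cheb m t = 2.

Lemma rational_angle_root t : rational_angle t ->
  exists2 m, (0 < m)%N & exists2 s : R[i], s ^+ m = 1 & toC t = s + s^-1.
Proof.
move=> [m m0 tm]; exists m => //; apply: cheb_eq2 => //.
by rewrite -(cheb_morph (real_complex R : {rmorphism R -> R[i]})) tm rmorph_nat.
Qed.

Definition evm (r : R[i]) : {rmorphism {poly int} -> R[i]} :=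
  horner_eval r \o map_poly intr.

(** The three roots of unity are powers of a single one, whose order is the product of the three
    exponents. *)
Lemma rational_triple_poly (x y z : R) :
    rational_angle x -> rational_angle y -> rational_angle z ->
  exists d (zeta : R[i]) (Q : {poly int} * {poly int} * {poly int}),
    [/\ (0 < d)%N, ev 'Phi_d zeta = 0 & map3 (evm zeta) Q = map3 toC (x, y, z)].
Proof.
move=> /rational_angle_root[m1 m1_gt0 [s1 s1m xE]].
move=> /rational_angle_root[m2 m2_gt0 [s2 s2m yE]].
move=> /rational_angle_root[m3 m3_gt0 [s3 s3m zE]].
pose n := (m1 * m2 * m3)%N.
have n0 : (0 < n)%N by rewrite !muln_gt0 m1_gt0 m2_gt0.
have [zeta prim_z] := exists_prim_root (R[i] : numClosedFieldType) n0.
have [d d0 Phi_z] := prim_root_Cyclotomic prim_z.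
have lift s m : (m %| n)%N -> s ^+ m = 1 -> exists Q, evm zeta Q = s + s^-1.
  move=> /dvdnP[k nE] sm; have sn : s ^+ n = 1 by rewrite nE mulnC exprM sm expr1n.
  (* The inverse of zeta^i is written zeta^(n - i) to stay polynomial in zeta. *)
  have [i sE] := prim_rootP prim_z sn; exists ('X^i + 'X^(n - i)).
  rewrite rmorphD; congr (_ + _); first by rewrite -[LHS]/(ev _ _) evXn sE.
  rewrite -[LHS]/(ev _ _) evXn sE.
  have z0 : zeta != 0.
    apply: contra_eq_neq (prim_expr_order prim_z) => ->.
    by rewrite expr0n gtn_eqF // eq_sym oner_eq0.
  apply: (mulfI (expf_neq0 i z0)).
  by rewrite -exprD subnKC ?(ltnW (ltn_ord i)) // (prim_expr_order prim_z) divff ?expf_neq0.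
have [Q1 Q1E] := lift s1 m1 ltac:(by rewrite /n -mulnA dvdn_mulr) s1m.
have [Q2 Q2E] := lift s2 m2 ltac:(by rewrite /n mulnAC dvdn_mull) s2m.
have [Q3 Q3E] := lift s3 m3 ltac:(by rewrite /n dvdn_mull) s3m.
exists d, zeta, (Q1, Q2, Q3); split=> //=.
by rewrite -Q1E in xE; rewrite -Q2E in yE; rewrite -Q3E in zE; rewrite xE yE zE.
Qed.

(* If every orbit coordinate is 2 cos of a rational angle, so is each of its
   Galois conjugates; hence the conjugate orbits stay in the box and the
   conjugate representations are again unitary. *)
Lemma conjugate_unitary (p : R * R * R) d zeta r Q :
    (forall x y z, gamma_orbit p (x, y, z) -> rational_angle x) -> (0 < d)%N ->
    ev 'Phi_d zeta = 0 -> ev 'Phi_d r = 0 -> map3 (evm zeta) Q = map3 toC p ->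
  exists A B : 'M[R[i]]_2, [/\ SU2 A, SU2 B & map3 toC (coords A B) = map3 (evm r) Q].
Proof.
move=> rat d0 Phi_z Phi_r QE.
(* The integer polynomial cheb m - 2, applied to the first coordinate of the twisted triple,
   vanishes at zeta, hence at [r]; so the conjugate coordinate is again real and at most 2 in
   absolute value. *)
have real1 w : exists2 u : R, evm r (twists w Q).1.1 = toC u & `|u| <= 2.
  have [x [y [z pE]]] : exists x y z, twists w p = (x, y, z).
    by case: (twists w p) => [[x y] z]; exists x, y, z.
  have [|m m0 xm] := rat x y z; first by rewrite -pE; apply/gamma_orbitP; exists w.
  apply: (cheb_eq2_real m0); rewrite -cheb_morph; apply/eqP; rewrite -subr_eq0.
  apply/eqP; rewrite -(rmorph_nat (evm r) 2) -rmorphB.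
  apply: (Cyclotomic_conj Phi_z) => //; rewrite -[LHS]/(evm zeta _) rmorphB cheb_morph.
  have -> : evm zeta (twists w Q).1.1 = (map3 (evm zeta) (twists w Q)).1.1.
    by case: (twists w Q) => [[? ?] ?].
  rewrite map_twists QE -map_twists pE /=.
  by rewrite -(cheb_morph (real_complex R : {rmorphism R -> R[i]})) xm !rmorph_nat subrr.
case: Q QE real1 => [[Q1 Q2] Q3] QE real1.
have [x xE _] := real1 [::].
have [y] := real1 cyc_word; rewrite twists_cyc => yE _.
have [z] := real1 (cyc_word ++ cyc_word); rewrite twists_cat (twists_cyc Q1) twists_cyc => zE _.
have p'E : map3 (evm r) (Q1, Q2, Q3) = map3 toC (x, y, z) by move: xE yE zE => /= -> -> ->.
(* Twists commute with evaluation at [r], so the orbit of the conjugate triple is the conjugate of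
   the orbit and stays in the box; [orbit_box_kappa] and [coords_surj] then apply. *)
have box x' y' z' : gamma_orbit (x, y, z) (x', y', z') -> `|x'| <= 2.
  case/gamma_orbitP => w E; have [u uE u2] := real1 w.
  suff -> : x' = u by [].
  apply: (@complexI R); rewrite -uE.
  have -> : toC x' = (map3 toC (twists w (x, y, z))).1.1 by rewrite -E.
  by rewrite map_twists -p'E -map_twists; case: (twists w _) => [[? ?] ?].
have Oxyz := orb_base (x, y, z).
have bx := box _ _ _ Oxyz; have by_ := box _ _ _ (gamma_orbit_cyc Oxyz).
have bz := box _ _ _ (gamma_orbit_cyc (gamma_orbit_cyc Oxyz)).
rewrite !ler_norml in bx by_ bz.
have [A [B [sA sB cE]]] := coords_surj bx by_ bz (orbit_box_kappa box).
by exists A, B; split=> //; rewrite cE.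
Qed.

Lemma rational_orbit_not_dense (A B : 'M[R[i]]_2) : SU2 A -> SU2 B ->
    (forall x y z, gamma_orbit (coords A B) (x, y, z) -> rational_angle x) ->
  ~ dense_in_SU2 (gen_sub A B).
Proof.
move=> sA sB rat dAB; set p := coords A B in rat.
have [d [zeta [Q [d0 Phi_z QE]]]] :
    exists d (zeta : R[i]) (Q : {poly int} * {poly int} * {poly int}),
    [/\ (0 < d)%N, ev 'Phi_d zeta = 0 & map3 (evm zeta) Q = map3 toC p].
  case: p rat => [[x y] z] rat; have O := orb_base (x, y, z).
  apply: rational_triple_poly; first exact: rat O.
    exact: rat (gamma_orbit_cyc O).
  exact: rat (gamma_orbit_cyc (gamma_orbit_cyc O)).
have [rs uniq_rs PhiE] := Cyclotomic_split (R[i] : numClosedFieldType) d0.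
have in_rs r : (r \in rs) = (ev 'Phi_d r == 0).
  by rewrite -root_prod_XsubC -PhiE.
have z_rs : zeta \in rs by rewrite in_rs Phi_z.
(* The norm will have one factor below [e] and fewer than [size rs] others, each at most 2. *)
pose e : R := (2 ^+ size rs)^-1.
have e0 : 0 < e by rewrite invr_gt0 exprn_gt0.
have [g /(gen_sub_word sA sB)[w ->] /andP[g0 ge]] := dense_small_trace sA sB dAB e0.
(* The trace of the word as an integer polynomial: its value at a root [r] is the trace of the same
   word in the representation conjugate at [r]. *)
pose P := (quad_word Q.1.1 Q.1.2 Q.2 w).1.1.1.
have trP A' B' r : SU2 A' -> SU2 B' -> map3 toC (coords A' B') = map3 (evm r) Q ->
    ev P r = toC (rtr (word A' B' w)).
  move=> sA' sB'; rewrite map_coords // /P; case: (Q) => [[Q1 Q2] Q3] /= [E1 E2 E3].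
  have := map_quad_word (evm r) Q1 Q2 Q3 w.
  case: (quad_word Q1 Q2 Q3 w) => [[[t a] b] c] /=.
  rewrite -E1 -E2 -E3 -quad_wordE ?sA'.2 ?sB'.2 // /quad => -[E _ _ _].
  by rewrite -SU2_tr; [exact: esym E | exact: word_SU2].
have Pz : ev P zeta = toC (rtr (word A B w)) by apply: trP => //; rewrite QE.
have Pr r : r \in rs -> ev P r = toC (complex.Re (ev P r)) /\ `|complex.Re (ev P r)| <= 2.
  rewrite in_rs => /eqP Phi_r.
  have [A' [B' [sA' sB' cE]]] := conjugate_unitary rat d0 Phi_z Phi_r QE.
  rewrite (trP _ _ _ sA' sB' cE) /=; split=> //.
  by rewrite ler_norml; apply: SU2_rtr_bound; exact: word_SU2.
(* A zero at one root of Phi_d would be a zero at zeta, where the trace is positive. *)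
have Pr0 r : r \in rs -> complex.Re (ev P r) != 0.
  move=> r_rs; apply/eqP => Re0; have Phi_r : ev 'Phi_d r = 0 by apply/eqP; rewrite -in_rs.
  have P0 : ev P r = 0 by rewrite (Pr _ r_rs).1 Re0.
  have := Cyclotomic_conj Phi_r Phi_z d0 P0; rewrite Pz.
  by move/complexI => g00; rewrite g00 ltxx in g0.
have [m mE] := norm_int P (Cyclotomic_monic d) uniq_rs PhiE.
have {}mE : \prod_(r <- rs) complex.Re (ev P r) = m%:~R.
  apply: (@complexI R); rewrite rmorph_prod rmorph_int -mE.
  by apply: eq_big_seq => r /Pr[E _]; exact: esym E.
have m0 : m%:~R != 0 :> R.
  by rewrite -mE prodf_seq_neq0; apply/allP => r /Pr0.
have : `|m%:~R| < 1 :> R.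
  rewrite -mE normr_prod (big_rem zeta) //= Pz /= gtr0_norm //.
  have le2 : \prod_(r <- rem zeta rs) `|complex.Re (ev P r)| <= 2 ^+ size rs.
    have : {subset rem zeta rs <= rs} by move=> r /mem_rem.
    have -> : size rs = (size (rem zeta rs)).+1.
      by rewrite size_rem // prednK //; case: (rs) z_rs.
    move=> sub; apply: (@le_trans _ _ (2 ^+ size (rem zeta rs))); last first.
      by rewrite exprS ler_peMl ?exprn_ge0 // ler1n.
    elim: (rem zeta rs) sub => [_|r l IH sub]; first by rewrite big_nil.
    rewrite big_cons /= exprS; apply: ler_pM => //; first by rewrite prodr_ge0.
      by apply: (Pr r _).2; apply: sub; rewrite mem_head.
    by apply: IH => s sl; apply: sub; rewrite inE sl orbT.
  apply: (@le_lt_trans _ _ (rtr (word A B w) * 2 ^+ size rs)).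
    by rewrite ler_pM2l.
  by rewrite -ltr_pdivlMr ?exprn_gt0 // div1r.
move: m0; rewrite -intr_norm intr_eq0 ltrz1; case: m {mE} => -[|n] //.
Qed.

End RationalAngle.

(** * Irrational rotations *)

Section Kronecker.
Variable R : realType.
Implicit Types (a t x y z : R).

Lemma continuous_at_lt (f : R -> R) a e : {for a, continuous f} -> 0 < e ->
  exists2 d, 0 < d & forall t, `|a - t| < d -> `|f a - f t| < e.
Proof.
move=> /cvgrPdist_lt fa e0; have /nbhs_ballP[d d0 ad] := fa e e0.
by exists d => // t; apply: ad.
Qed.

Lemma cos_sin_intr (l : int) t :
  cos (t + l%:~R * (pi *+ 2)) = cos t /\ sin (t + l%:~R * (pi *+ 2)) = sin t.
Proof.
have nat_case n (u : R) : cos (u + n%:R * (pi *+ 2)) = cos u /\ sin (u + n%:R * (pi *+ 2)) = sin u.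
  by rewrite mulr_natl; split; apply: periodicn => v; [exact: cosD2pi | exact: sinD2pi].
case: l => n; first exact: nat_case.
have [c s] := nat_case n.+1 (t + (Negz n)%:~R * (pi *+ 2)).
by rewrite NegzE mulrNz mulNr subrK in c s *.
Qed.

(** Dirichlet's pigeonhole: among K + 1 multiples of t modulo 2 pi, two share one of K bins of width
    below e. Their difference d satisfies 0 < |d| < e. *)
Lemma kronecker t b e : (forall m, (0 < m)%N -> cos (m%:R * t) != 1) -> 0 < e ->
  exists j l : int, `|j%:~R * t + l%:~R * (pi *+ 2) - b| < e.
Proof.
move=> irr e0; set T : R := pi *+ 2.
have T0 : 0 < T by rewrite pmulrn_rgt0 // pi_gt0.
pose K := (Num.truncn (T / e)).+1.
have TK : T < K%:R * e by rewrite -ltr_pdivrMr // /K; exact: truncnS_gt.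
have K0 : 0 < K%:R :> R by rewrite ltr0n.
pose f (j : nat) : R := j%:R * t - T * (Num.floor (j%:R * t / T))%:~R.
have f_itv j : 0 <= f j * K%:R / T < K%:R.
  have /andP[h1 h2] := floor_itv (j%:R * t / T).
  rewrite ler_pdivlMr // in h1; rewrite ltr_pdivrMr // intrD in h2.
  have f0 : 0 <= f j by rewrite /f; lra.
  have f1 : f j < T by rewrite /f; lra.
  apply/andP; split; first by rewrite divr_ge0 ?mulr_ge0 // ltW.
  by rewrite ltr_pdivrMr // mulrC ltr_pM2l.
pose bin (j : 'I_K.+1) : 'I_K := inord (Num.truncn (f j * K%:R / T)).
have binE j : bin j = Num.truncn (f j * K%:R / T) :> nat.
  by rewrite inordK // -/K truncn_lt_nat; have /andP[] := f_itv j.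
have [j1 [j2 [j12 bin12]]] : exists j1 j2 : 'I_K.+1, (j1 < j2)%N /\ bin j1 = bin j2.
  have /injectivePn[i [j ij bij]] : ~~ injectiveb bin.
    by apply/negP => /injectiveP/leq_card; rewrite !card_ord ltnn.
  move: ij; rewrite neq_ltn => /orP[ij|ij]; first by exists i, j.
  by exists j, i.
pose l : int := Num.floor (j1%:R * t / T) - Num.floor (j2%:R * t / T).
pose d := (j2 - j1)%N%:R * t + l%:~R * T.
have dE : d = f j2 - f j1.
  by rewrite /d /f /l natrB 1?ltnW // rmorphB /=; ring.
have de : `|d| < e.
  have TKe : T / K%:R < e by rewrite ltr_pdivrMr // mulrC.
  apply: lt_trans TKe; rewrite dE ltr_pdivlMr //.
  have tr j := truncn_itv (proj1 (andP (f_itv j))).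
  have := tr j1; have := tr j2; rewrite -!binE bin12 => /andP[a1 a2] /andP[b1 b2].
  rewrite -[ltLHS]ger0_norm ?mulr_ge0 ?(ltW K0) // normrM normr_id -normrM.
  have -> : (f j2 - f j1) * K%:R = T * (f j2 * K%:R / T - f j1 * K%:R / T).
    by field; apply/eqP; lra.
  rewrite normrM (gtr0_norm T0) -[ltRHS]mulr1 ltr_pM2l //.
  rewrite -natr1 in a2 b2; rewrite ltr_norml; apply/andP; split; lra.
have d0 : d != 0.
  apply/eqP => d0; have := irr (j2 - j1)%N; rewrite subn_gt0 => /(_ j12).
  by have := (cos_sin_intr l ((j2 - j1)%N%:R * t)).1; rewrite -/T -/d d0 cos0 => <-; rewrite eqxx.
(* The multiple q d is within |d| of b. *)
pose q := Num.floor (b / d).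
exists (q * (j2 - j1)%N%:Z), (q * l).
have -> : (q * (j2 - j1)%N%:Z)%:~R * t + (q * l)%:~R * T - b = q%:~R * d - b.
  by rewrite /d !intrM; ring.
apply: le_lt_trans de.
have -> : q%:~R * d - b = (q%:~R - b / d) * d by field.
rewrite normrM ler_piMl // ler_norml.
have /andP[h1 h2] := floor_itv (b / d); rewrite intrD -/q in h2; rewrite -/q in h1.
by apply/andP; split; lra.
Qed.

Lemma polar (c s : R) : c ^+ 2 + s ^+ 2 = 1 -> exists a, c = cos a /\ s = sin a.
Proof.
move=> cs; have c1 : -1 <= c <= 1 by have := sqr_ge0 s; nra.
have cE : cos (acos c) = c by rewrite acosK // in_itv.
have sE : sin (acos c) ^+ 2 = s ^+ 2 by rewrite sin2cos2 cE -cs; ring.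
move/eqP: sE; rewrite eqf_sqr => /orP[/eqP sE|/eqP sE].
  by exists (acos c).
by exists (- acos c); rewrite cosN sinN cE sE opprK.
Qed.

Lemma cheb_cos m t : cheb m (2 * cos t) = 2 * cos (m%:R * t).
Proof.
elim/nat_ind2: m => [||m IH1 IH2]; rewrite ?mul0r ?cos0 ?mulr1 ?mul1r //.
rewrite chebSS IH1 IH2.
have -> : m.+2%:R * t = m.+1%:R * t + t by rewrite -(natr1 m.+1); ring.
have -> : m%:R * t = m.+1%:R * t - t by rewrite -(natr1 m); ring.
by rewrite cosB cosD; ring.
Qed.

(* u/(2w) with u odd: (2w)^m cheb m t is an odd integer for m > 0, so never 2 (2w)^m. *)
Lemma not_rational_angle_dense a e : 0 < e ->
  exists2 t, `|a - t| < e & ~ rational_angle t.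
Proof.
move=> e0; pose w := (Num.truncn e^-1).+1.
have w0 : 0 < w%:R :> R by rewrite ltr0n.
have we : w%:R^-1 < e by rewrite invf_plt ?posrE // truncnS_gt.
(* The odd numerator is 2u + 1, which puts t within 1/(2w) of a. *)
pose u := Num.floor (a * w%:R); pose t : R := (2 * u%:~R + 1) / (2 * w%:R).
exists t.
  have /andP[h1 h2] := floor_itv (a * w%:R); rewrite intrD -/u in h2; rewrite -/u in h1.
  apply: lt_trans we; have -> : a - t = (a * w%:R - u%:~R - 1 / 2) / w%:R.
    by rewrite /t; field; apply/eqP; lra.
  rewrite normrM [X in _ * X]gtr0_norm ?invr_gt0 // gtr_pMl ?invr_gt0 //.
  by rewrite ltr_norml; apply/andP; split; lra.
pose q : R := 2 * w%:R.
have q0 : q != 0 by apply/eqP; rewrite /q; lra.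
(* Two successive terms feed the recurrence; the earlier one need only be integral, because its
   coefficient q^2 is even. *)
have odd m : (exists k : int, q ^+ m * cheb m t = k%:~R) /\
             (exists k : int, q ^+ m.+1 * cheb m.+1 t = (2 * k + 1)%:~R).
  elim: m => [|m [[k1 E1] [k2 E2]]].
    split; first by exists 2; rewrite mul1r.
    exists u; rewrite expr1 /= /t mulrC divfK //.
    by rewrite intrD intrM.
  split; first by exists (2 * k2 + 1).
  exists (2 * u * k2 + u + k2 - 2 * w%:Z * w%:Z * k1).
  have -> : q ^+ m.+2 * cheb m.+2 t =
      (q * t) * (q ^+ m.+1 * cheb m.+1 t) - q ^+ 2 * (q ^+ m * cheb m t).
    by rewrite chebSS !exprS; ring.
  have -> : q * t = 2 * u%:~R + 1 by rewrite mulrC divfK.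
  rewrite E1 E2 /q !(intrD, intrM, rmorphN) /=; ring.
move=> [[//|m] _ tm]; have [_ [k]] := odd m; rewrite tm => E.
have : ((2 * w%:Z) ^+ m.+1 * 2)%:~R = (2 * k + 1)%:~R :> R.
  by rewrite -E intrM rmorphXn /= intrM.
move/intr_inj; move: (_ ^+ _) => s; lia.
Qed.

End Kronecker.

(** * Closed twist-stable sets *)

Section Closure.
Variable R : realType.
Implicit Types (p q : R * R * R) (a b c e k t x y z : R).

Lemma dist3_lt x y z x' y' z' (e : R) :
  dist3 (x, y, z) (x', y', z') < e <-> [/\ `|x - x'| < e, `|y - y'| < e & `|z - z'| < e].
Proof.
rewrite /dist3 !gt_max; split; first by case/and3P.
by case=> -> -> ->.
Qed.

Definition closed3 (S : R * R * R -> Prop) :=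
  forall p, (forall e : R, 0 < e -> exists2 q, S q & dist3 p q < e) -> S p.

Definition twist_stable (S : R * R * R -> Prop) := forall l p, S p -> S (twist l p).

Definition closure3 (S : R * R * R -> Prop) p :=
  forall e : R, 0 < e -> exists2 q, S q & dist3 p q < e.

Lemma closure3_closed S : closed3 (closure3 S).
Proof.
move=> [[x y] z] clp e e0; have e2 : 0 < e / 2 by lra.
have [[[x1 y1] z1] clq /dist3_lt[h1 h2 h3]] := clp _ e2.
have [[[x2 y2] z2] Sq /dist3_lt[k1 k2 k3]] := clq _ e2.
exists (x2, y2, z2) => //; apply/dist3_lt.
by rewrite !ltr_norml in h1 h2 h3 k1 k2 k3 *; split; lra.
Qed.

Lemma dist_mul (u v u' v' d : R) : d <= 1 -> `|u - u'| < d -> `|v - v'| < d ->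
  `|u * v - u' * v'| <= (`|u| + `|v| + 1) * d.
Proof.
move=> d1 hu hv.
have -> : u * v - u' * v' = u * (v - v') + (u - u') * v - (u - u') * (v - v') by ring.
apply: le_trans (ler_normB _ _) _; apply: le_trans (lerD (ler_normD _ _) (lexx _)) _.
rewrite !normrM; have := normr_ge0 u; have := normr_ge0 v.
have := normr_ge0 (u - u'); have := normr_ge0 (v - v'); nra.
Qed.

Lemma twist_continuous l p : exists2 L : R, 0 < L &
  forall q d, d <= 1 -> dist3 p q < d -> dist3 (twist l p) (twist l q) < L * d.
Proof.
case: p => [[x y] z]; exists (`|x| + `|y| + `|z| + 3).
  by rewrite ltr_wpDl // !addr_ge0.
move=> [[x' y'] z'] d d1 /dist3_lt[hx hy hz].
have d0 : 0 < d by apply: le_lt_trans hx.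
have := normr_ge0 x; have := normr_ge0 y; have := normr_ge0 z => z0 y0 x0.
have L1 : d <= (`|x| + `|y| + `|z| + 3) * d by rewrite ler_peMl ?ltW //; lra.
have mul u v w u' v' w' : `|u| + `|v| <= `|x| + `|y| + `|z| ->
   `|u - u'| < d -> `|v - v'| < d -> `|w - w'| < d ->
   `|u * v - w - (u' * v' - w')| < (`|x| + `|y| + `|z| + 3) * d.
  move=> uv hu hv hw; have -> : u * v - w - (u' * v' - w') = (u * v - u' * v') - (w - w') by ring.
  apply: le_lt_trans (ler_normB _ _) _.
  have := dist_mul d1 hu hv.
  have : (`|u| + `|v|) * d <= (`|x| + `|y| + `|z|) * d by rewrite ler_pM2r.
  by move: (`|u|) (`|v|) (`|_ - _|) (`|w - w'|) hw => *; lra.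
by case: l => [[] []] /=; apply/dist3_lt; split; try (by apply: lt_le_trans L1);
   apply: mul => //; lra.
Qed.

Lemma closure3_twist S : twist_stable S -> twist_stable (closure3 S).
Proof.
move=> St l p clp e e0; have [L L0 Lp] := twist_continuous l p.
pose d := Num.min 1 (e / L).
have d0 : 0 < d by rewrite lt_min ltr01 divr_gt0.
have [q Sq pq] := clp _ d0; exists (twist l q); first exact: St.
have d1 : d <= 1 by rewrite ge_min lexx.
apply: lt_le_trans (Lp q d d1 pq) _.
by rewrite mulrC -ler_pdivlMr // ge_min lexx orbT.
Qed.

Lemma closed3_cyc (S : R * R * R -> Prop) x y z : twist_stable S -> S (x, y, z) -> S (y, z, x).
Proof.
move=> St Sp; rewrite -twists_cyc; elim: cyc_word => //= l w; exact: St.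
Qed.

(* tau_X rotates the ellipse of fixed x = 2 cos t by the angle t, in the
   parametrisation y = r sin a, z = r sin (a + t). *)
Lemma slice_subset S x y z y' z' : closed3 S -> twist_stable S -> S (x, y, z) ->
    ~ rational_angle x -> -2 < x < 2 ->
    y' ^+ 2 + z' ^+ 2 - x * y' * z' = y ^+ 2 + z ^+ 2 - x * y * z ->
  S (x, y', z').
Proof.
move=> Scl St Sp irr x2 E.
pose t := acos (x / 2).
have x1 : -1 <= x / 2 <= 1 by apply/andP; split; lra.
have ct : cos t = x / 2 by rewrite acosK // in_itv.
have xE : x = 2 * cos t by rewrite ct; field.
have st : 0 < sin t by rewrite sin_acos // sqrtr_gt0; nra.
have st2 : sin t ^+ 2 = 1 - cos t ^+ 2 by rewrite sin2cos2.
pose Q := y ^+ 2 + z ^+ 2 - x * y * z.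
have Q0 : 0 <= Q.
  rewrite /Q xE.
  have -> : y ^+ 2 + z ^+ 2 - 2 * cos t * y * z = (z - y * cos t) ^+ 2 + (y * sin t) ^+ 2.
    by rewrite exprMn st2; ring.
  by rewrite addr_ge0 ?sqr_ge0.
pose r := Num.sqrt Q / sin t.
have param u v : u ^+ 2 + v ^+ 2 - x * u * v = Q ->
    exists a, u = r * sin a /\ v = r * sin (a + t).
  (* For Q = 0 the ellipse is the origin; otherwise a point is normalised by sqrt Q to the unit
     circle. *)
  move=> uvQ; have [Q00|Qn0] := eqVneq Q 0.
    have : (v - u * cos t) ^+ 2 + (u * sin t) ^+ 2 = 0.
      by rewrite exprMn st2 -Q00 -uvQ xE; ring.
    move/eqP; rewrite paddr_eq0 ?sqr_ge0 // !sqrf_eq0 mulf_eq0 (gt_eqF st) orbF.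
    case/andP => /eqP v0 /eqP u0; exists 0.
    rewrite /r Q00 sqrtr0 !mul0r; split=> //.
    by move: v0; rewrite u0 mul0r subr0.
  have sQ0 : Num.sqrt Q != 0 by rewrite sqrtr_eq0 -ltNge lt_def Qn0.
  have sQ2 : Num.sqrt Q ^+ 2 = Q by rewrite sqr_sqrtr.
  have stn0 : sin t != 0 by rewrite gt_eqF.
  have [|a [ca sa]] := @polar R ((v - u * cos t) / Num.sqrt Q) (u * sin t / Num.sqrt Q).
    rewrite !expr_div_n sQ2 -mulrDl exprMn st2.
    by apply: (canLR (mulfK Qn0)); rewrite mul1r -uvQ xE; ring.
  exists a; rewrite sinD -ca -sa /r.
  by split; field; rewrite sQ0 stn0.
have [a [yE zE]] := param y z erefl.
have [b [y'E z'E]] := param y' z' E.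
(* The j-th power of tau_X, negative powers included, shifts the parameter by jt. *)
have rot (j : int) : S (x, r * sin (a + j%:~R * t), r * sin (a + j%:~R * t + t)).
  have dbl u : 2 * cos t * (r * sin (u + t)) - r * sin u = r * sin (u + t + t).
    have -> : sin u = sin (u + t - t) by rewrite addrK.
    by move: (u + t) => v; rewrite sinB sinD; ring.
  have dblV u : 2 * cos t * (r * sin u) - r * sin (u + t) = r * sin (u - t).
    by rewrite sinB sinD; ring.
  case: j => n.
    elim: n => [|n IH]; first by rewrite mul0r addr0 -yE -zE.
    have := St (false, false) _ IH; rewrite /= {2}xE dbl.
    suff -> : a + (Posz n.+1)%:~R * t = a + (Posz n)%:~R * t + t by [].
    by rewrite -!pmulrn -natr1; ring.
  elim: n => [|n IH].
    have := St (false, true) _ Sp; rewrite /= {2}xE yE zE dblV NegzE mulrN1z mulN1r.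
    by rewrite subrK.
  have := St (false, true) _ IH; rewrite /= {2}xE dblV.
  suff -> : a + (Negz n.+1)%:~R * t = a + (Negz n)%:~R * t - t by rewrite subrK.
  by rewrite !NegzE !mulrNz -!pmulrn -(natr1 n.+1); ring.
apply: Scl => e e0.
(* The added 1 covers r = 0. *)
have e'0 : 0 < e / (`|r| + 1) by rewrite divr_gt0 // ltr_wpDl.
have [d1 d10 h1] := continuous_at_lt (@continuous_sin R b) e'0.
have [d2 d20 h2] := continuous_at_lt (@continuous_sin R (b + t)) e'0.
have irrt m : (0 < m)%N -> cos (m%:R * t) != 1.
  move=> m0; apply/eqP => cm; apply: irr; exists m => //.
  by rewrite xE cheb_cos cm mulr1.
have d0 : 0 < Num.min d1 d2 by rewrite lt_min d10.
have [j [l]] := kronecker (b - a) irrt d0; rewrite lt_min => /andP[k1 k2].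
exists (x, r * sin (a + j%:~R * t), r * sin (a + j%:~R * t + t)) => //.
have small s s' : `|s - s'| < e / (`|r| + 1) -> `|r * s - r * s'| < e.
  move=> hs; rewrite -mulrBr normrM.
  apply: (@le_lt_trans _ _ ((`|r| + 1) * `|s - s'|)).
    by apply: ler_wpM2r => //; rewrite lerDl.
  by rewrite mulrC -ltr_pdivlMr // ltr_wpDl.
have [_ sl1] := cos_sin_intr l (a + j%:~R * t).
have [_ sl2] := cos_sin_intr l (a + j%:~R * t + t).
apply/dist3_lt; split; first by rewrite subrr normr0.
  rewrite y'E; apply: small; rewrite -sl1; apply: h1; rewrite distrC.
  by move: k1; congr (`|_| < _); ring.
rewrite z'E; apply: small; rewrite -sl2; apply: h2; rewrite distrC.
by move: k2; congr (`|_| < _); ring.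
Qed.

(** kappa <= 2 reads (2z - xy)^2 <= (4 - x^2)(4 - y^2), and the right side is at most (4 - xy)^2 and
    (4 + xy)^2. This keeps twists inside the box. *)
Lemma kappa_box x y z : -2 <= x <= 2 -> -2 <= y <= 2 -> -2 <= z <= 2 ->
  kappa (x, y, z) <= 2 -> -2 <= x * y - z <= 2.
Proof.
rewrite /kappa => hx hy hz k2.
pose s := 2 * z - x * y.
have s2 : s ^+ 2 <= (4 - x ^+ 2) * (4 - y ^+ 2) by rewrite /s; nra.
have xy4 : -4 <= x * y <= 4 by apply/andP; split; nra.
have b1 : (4 - x ^+ 2) * (4 - y ^+ 2) <= (4 - x * y) ^+ 2.
  by have := sqr_ge0 (x - y); nra.
have b2 : (4 - x ^+ 2) * (4 - y ^+ 2) <= (4 + x * y) ^+ 2.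
  by have := sqr_ge0 (x + y); nra.
have -> : x * y - z = (x * y - s) / 2 by rewrite /s; field.
move: s s2 => s s2; apply/andP; split.
  have : s <= 4 + x * y; last by lra.
  rewrite leNgt; apply/negP => h; have := le_trans s2 b2.
  by rewrite leNgt ltr_pXn2r ?h // nnegrE; lra.
have : - s <= 4 - x * y; last by lra.
rewrite leNgt; apply/negP => h; have := le_trans s2 b1.
by rewrite -sqrrN leNgt ltr_pXn2r ?h // nnegrE; lra.
Qed.

Definition in_box p := let: (x, y, z) := p in [/\ -2 <= x <= 2, -2 <= y <= 2 & -2 <= z <= 2].

Lemma gamma_orbit_box p q : in_box p -> kappa p <= 2 -> gamma_orbit p q -> in_box q.
Proof.
move=> bp kp /gamma_orbitP[w ->]; elim: w => //= l w.
have : kappa (twists w p) <= 2.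
  by rewrite (@kappa_orbit R p) //; apply/gamma_orbitP; exists w.
case: (twists w p) => [[x y] z]; rewrite /kappa => k [hx hy hz].
case: l => [[] []]; split => //; apply: kappa_box => //; rewrite /kappa; lra.
Qed.

(** At x = 2 or x = -2, kappa - 2 is the square of y - z or y + z. *)
Lemma kappa_slice_neq2 x y z : kappa (x, y, z) < 2 -> -2 <= x <= 2 -> -2 < x < 2.
Proof.
rewrite /kappa => k /andP[x1 x2]; rewrite !lt_neqAle x1 x2 !andbT; apply/andP; split.
  by apply/eqP => e; have := sqr_ge0 (y + z); rewrite -e in k; lra.
by apply/eqP => e; have := sqr_ge0 (y - z); rewrite e in k; lra.
Qed.

Lemma slice_pos x y z : -2 < x < 2 -> ~ (y = 0 /\ z = 0) ->
  0 < y ^+ 2 + z ^+ 2 - x * y * z.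
Proof.
move=> /andP[x1 x2] yz; have x4 : 0 < 4 - x ^+ 2 by nra.
have sos u v :
    4 * (u ^+ 2 + v ^+ 2 - x * u * v) = (2 * v - x * u) ^+ 2 + (4 - x ^+ 2) * u ^+ 2 by ring.
have pos u v : u != 0 -> 0 < u ^+ 2 + v ^+ 2 - x * u * v.
  move=> u0; rewrite -(pmulr_rgt0 _ (ltr0n R 4)) sos ltr_wpDl ?sqr_ge0 //.
  by rewrite mulr_gt0 // exprn_even_gt0.
have [y0|/pos //] := eqVneq y 0.
have [z0|/(pos z y)] := eqVneq z 0; first by case: yz.
by congr (_ < _); ring.
Qed.

(** Discriminant of kappa(x, y, z) = k as a quadratic equation in z. *)
Definition disc (k x y : R) : R := (4 - x ^+ 2) * (4 - y ^+ 2) - 4 * (2 - k).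

Lemma slice_root k x y (s : R) : 0 <= disc k x y -> s ^+ 2 = 1 ->
  kappa (x, y, (x * y + s * Num.sqrt (disc k x y)) / 2) = k.
Proof.
move=> D0 s1; rewrite /kappa.
have : (s * Num.sqrt (disc k x y)) ^+ 2 = disc k x y by rewrite exprMn s1 mul1r sqr_sqrtr.
by move: (s * _) => w; rewrite /disc => E; lra.
Qed.

(** When 2c differs from ab, c is a simple root; the branch of the root formula selected by the sign
    of 2c - ab is continuous. *)
Lemma slice_root_near k a b c e : kappa (a, b, c) = k -> 2 * c - a * b != 0 -> 0 < e ->
  exists2 d, 0 < d & forall a', `|a - a'| < d ->
    exists2 c', kappa (a', b, c') = k & `|c - c'| < e.
Proof.
move=> kE cab e0; pose s := Num.sg (2 * c - a * b).
have s1 : s ^+ 2 = 1 by rewrite sqr_sg cab.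
have DE : disc k a b = (2 * c - a * b) ^+ 2 by rewrite -kE /disc /kappa; ring.
have Dpos : 0 < disc k a b by rewrite DE exprn_even_gt0.
have contD : {for a, continuous (fun t => disc k t b)}.
  apply: cvgB; last exact: cvg_cst.
  apply: cvgM; last exact: cvg_cst.
  by apply: cvgB; [exact: cvg_cst | exact: exprn_continuous].
have contf : {for a, continuous (fun t => (t * b + s * Num.sqrt (disc k t b)) / 2)}.
  apply: cvgM; last exact: cvg_cst.
  apply: cvgD; first by apply: cvgM; [exact: cvg_id | exact: cvg_cst].
  apply: cvgM; first exact: cvg_cst.
  by apply: continuous_comp; [exact: contD | exact: sqrt_continuous].
have [d1 d10 h1] := continuous_at_lt contD Dpos.
have [d2 d20 h2] := continuous_at_lt contf e0.
exists (Num.min d1 d2); first by rewrite lt_min d10.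
move=> a'; rewrite lt_min => /andP[/h1 D' /h2].
have -> : (a * b + s * Num.sqrt (disc k a b)) / 2 = c.
  by rewrite DE sqrtr_sqr mulr_sg_norm; field.
move=> c'; exists ((a' * b + s * Num.sqrt (disc k a' b)) / 2) => //.
by apply: slice_root => //; move: D'; rewrite ltr_norml => /andP[]; lra.
Qed.

Lemma closed_stable_full S x0 y0 z0 : closed3 S -> twist_stable S -> S (x0, y0, z0) ->
    ~ rational_angle x0 -> -2 < x0 < 2 -> ~ (y0 = 0 /\ z0 = 0) -> kappa (x0, y0, z0) < 2 ->
  forall p, inEk (kappa (x0, y0, z0)) p -> S p.
Proof.
move=> Scl St S0 irr0 x02 yz0; have := slice_pos x02 yz0.
have : kappa (x0, y0, z0) = kappa (x0, y0, z0) by [].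
move: {2 3 4}(kappa (x0, y0, z0)) => k k0 pos0 k2.
have r0 : 0 < k + 2 - x0 ^+ 2 by move: k0; rewrite /kappa; lra.
have cyc x y z : S (x, y, z) -> S (y, z, x) by exact: closed3_cyc.
have slice x y z y' z' : S (x, y, z) -> ~ rational_angle x -> -2 < x < 2 ->
    kappa (x, y, z) = k -> kappa (x, y', z') = k -> S (x, y', z').
  move=> Sp irr x2 e1 e2; apply: slice_subset Sp irr x2 _ => //.
  by move: e1 e2; rewrite /kappa; lra.
have irr_slice a b c : ~ rational_angle a -> a ^+ 2 < k + 2 -> kappa (a, b, c) = k -> S (a, b, c).
  move=> irra a2 kabc.
  (* y^2 <= m makes the discriminants for (x0, y) and (y, a) non-negative, so the slice of [y] meets
     those of [x0] and [a]. *)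
  pose m := Num.min (k + 2 - x0 ^+ 2) (k + 2 - a ^+ 2).
  have m0 : 0 < m by rewrite lt_min r0 subr_gt0.
  have e0 : 0 < Num.min 1 m by rewrite lt_min ltr01.
  have [y yn irry] := not_rational_angle_dense 0 e0.
  move: yn; rewrite sub0r normrN lt_min => /andP[y1 ym].
  have ysq : y ^+ 2 <= m.
    rewrite -(real_normK (num_real y)); have := normr_ge0 y; nra.
  move: ysq; rewrite le_min => /andP[ym1 ym2].
  rewrite ltr_norml in y1.
  have D1 : 0 <= disc k x0 y by rewrite /disc; have := sqr_ge0 x0; have := sqr_ge0 y; nra.
  have D2 : 0 <= disc k y a by rewrite /disc; have := sqr_ge0 a; have := sqr_ge0 y; nra.
  have k1 := slice_root D1 (expr1n _ _); have k3 := slice_root D2 (expr1n _ _).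
  move: (_ / 2) k1 (_ / 2) k3 => z k1 c' k3.
  (* Each irrational slice is filled from one of its points: from the slice of [x0] to that of [y],
     then to that of [a]. *)
  have Sy : S (y, z, x0) by apply: cyc; apply: slice S0 irr0 x02 k0 k1.
  have Sa : S (a, c', y).
    apply: cyc; apply: slice Sy irry _ _ k3; first by apply/andP; split; lra.
    by rewrite -k1 /kappa; ring.
  apply: slice Sa irra _ _ kabc; first by apply/andP; split; nra.
  by rewrite -k3 /kappa; ring.
have near_slice a b c : kappa (a, b, c) = k -> -2 < a < 2 -> ~ (b = 0 /\ c = 0) -> S (a, b, c).
  move=> kabc a2 bc; have pos := slice_pos a2 bc.
  have ak : a ^+ 2 < k + 2 by move: kabc; rewrite /kappa; lra.
  have [d0 d00 near0] : exists2 d, 0 < d & forall t, `|a - t| < d -> t ^+ 2 < k + 2.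
    have ak0 : 0 < k + 2 - a ^+ 2 by lra.
    have [d d0 h] := continuous_at_lt (@exprn_continuous R 2 a) ak0.
    by exists d => // t /h; rewrite ltr_norml => /andP[h1 h2]; lra.
  apply: Scl => e e0.
  (* To move [a] to an irrational angle nearby, solve for c; if c is a double root, solve for b.
     Both are double only when b = c = 0. *)
  have [cab|cab] := eqVneq (2 * c - a * b) 0; last first.
    have [d d1 near1] := slice_root_near kabc cab e0.
    have m0 : 0 < Num.min e (Num.min d0 d) by rewrite !lt_min e0 d00.
    have [a' + irra] := not_rational_angle_dense a m0.
    rewrite !lt_min => /and3P[ae /near0 a'k /near1[c' kc' cc']].
    by exists (a', b, c'); [exact: irr_slice | apply/dist3_lt; rewrite subrr normr0].
  have bac : 2 * b - a * c != 0.
    apply/eqP => bac; apply: bc.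
    have b0 : (4 - a ^+ 2) * b = 0.
      have -> : (4 - a ^+ 2) * b = 2 * (2 * b - a * c) + a * (2 * c - a * b) by ring.
      by rewrite bac cab !mulr0 addr0.
    have b00 : b = 0.
      by move/eqP: b0; rewrite mulf_eq0 => /orP[/eqP h|/eqP //]; nra.
    by split=> //; rewrite b00 in cab; lra.
  have kacb : kappa (a, c, b) = k by rewrite -kabc /kappa; ring.
  have [d d1 near1] := slice_root_near kacb bac e0.
  have m0 : 0 < Num.min e (Num.min d0 d) by rewrite !lt_min e0 d00.
  have [a' + irra] := not_rational_angle_dense a m0.
  rewrite !lt_min => /and3P[ae /near0 a'k /near1[b' kb' bb']].
  exists (a', b', c); last by apply/dist3_lt; rewrite subrr normr0.
  by apply: irr_slice => //; rewrite -kb' /kappa; ring.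
move=> [[a b] c] [[a2 b2 c2 _] kabc].
have a2' : -2 < a < 2 by apply: (@kappa_slice_neq2 a b c) => //; rewrite kabc.
have [bc|bc] := pselect (b = 0 /\ c = 0); last exact: near_slice.
(* The point (a, 0, 0) is permuted to (0, 0, a), on the slice at 0; a = 0 would give k = -2, against
   [r0]. *)
case: bc kabc {b2 c2} => -> -> kabc; apply/cyc/cyc/near_slice.
- by rewrite -kabc /kappa; ring.
- by apply/andP; split; lra.
by case=> _ a0; move: kabc; rewrite a0 /kappa => kE; have := sqr_ge0 x0; lra.
Qed.

(** * Points on the coordinate axes, and the density theorem *)

Definition axis p := let: (x, y, z) := p in [/\ x * y = 0, y * z = 0 & x * z = 0].

(** Carries an axis point of the orbit back to its base point. *)
Lemma axis_twist l p : axis (twist l p) -> axis p.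
Proof.
case: p => [[x y] z]; case: l => [[] []] /= [h1 h2 h3].
- by rewrite h2 in h1 h3; split; lra.
- by rewrite [y * z]mulrC h1 in h2 h3; split; lra.
- by rewrite h3 in h1 h2; split; lra.
- by rewrite h1 in h2 h3; split; lra.
Qed.

End Closure.

(* sigma : pi_1(M) = F<X,Y> -> SU(2) is given by A = sigma X, B = sigma Y;
   K = X Y X^-1 Y^-1. *)
Theorem theorem2 (R : realType) (A B : 'M[R[i]]_2) :
  SU2 A -> SU2 B -> dense_in_SU2 (gen_sub A B) ->
  dense_in3 (gamma_orbit (coords A B))
            (inEk (rtr (A *m B *m invmx A *m invmx B)) ).
Proof.
move=> sA sB dAB; rewrite commutator_trace //.
have k2 := dense_kappa_lt2 sA sB dAB; have nd := dense_not_dihedral sA sB dAB.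
have bp : in_box (coords A B).
  by split; apply: SU2_rtr_bound => //; exact: SU2_mul.
set p := coords A B in k2 nd bp *.
have [[[x0 [y0 z0]] [O0 irr]]|rat] := pselect (exists q : R * (R * R),
    gamma_orbit p (q.1, q.2.1, q.2.2) /\ ~ rational_angle q.1); last first.
  case: (rational_orbit_not_dense sA sB _ dAB) => x y z O.
  by apply: contrapT => irr; apply: rat; exists (x, (y, z)).
rewrite /= in O0 irr.
have k0 := kappa_orbit O0.
have x0b : -2 < x0 < 2.
  have [hx _ _] := gamma_orbit_box bp (ltW k2) O0.
  by apply: (@kappa_slice_neq2 _ x0 y0 z0) => //; rewrite k0.
(* Otherwise the coordinates of sigma would already have two zeros, the dihedral case. *)
have yz0 : ~ (y0 = 0 /\ z0 = 0).
  case=> y00 z00; rewrite y00 z00 in O0.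
  have : axis p.
    have : axis (x0, 0, 0) by split; ring.
    by case/gamma_orbitP: O0 => w ->; elim: w => //= l w IH /axis_twist.
  case=> xy yz xz; case: nd => n1 [n2 n3].
  have [x00|xn0] := eqVneq (rtr A) 0.
    by move/eqP: yz; rewrite mulf_eq0 => /orP[]/eqP h; [apply: n3 | apply: n2].
  by apply: n1; split; apply: (mulfI xn0); rewrite mulr0.
rewrite -k0 => q qE e e0.
(* The closure of the orbit is closed, twist-stable and contains a point of irrational angle, so it
   contains E_k. *)
have cl_stable : twist_stable (closure3 (gamma_orbit p)).
  apply: closure3_twist => l q' /gamma_orbitP[w ->].
  by apply/gamma_orbitP; exists (l :: w).
have cl0 : closure3 (gamma_orbit p) (x0, y0, z0).
  by move=> e' e'0; exists (x0, y0, z0) => //; apply/dist3_lt; rewrite !subrr normr0.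
have k02 : kappa (x0, y0, z0) < 2 by rewrite k0.
have [q' Oq' dq'] :=
  closed_stable_full (@closure3_closed R _) cl_stable cl0 irr x0b yz0 k02 qE e e0.
by exists q'.
Qed.
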